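(* Let $M$ be a 4-dimensional connected, orientable smooth manifold, $a$ a Lorentzian metric on $M$ of signature $(+,-,-,-)$ and $b$ a 1-form on $M$; put $A=a_{ij}\dot x^i\dot x^j$, $B=b_i\dot x^i$, $s=B^2/A$. Let $p,k,m\in\mathbb{R}$ be constants with $k\ne0$, $m\neq0$. The Kundt metric $$L(x,\dot x)=A\,s^{-p}(k+ms)^{p+1}=B^{-2p}\left(kA+mB^2\right)^{p+1}$$ defines a Finsler spacetime structure if and only if $k>0$, $m<0$, and one of the following situations takes place: (i) $\langle b,b\rangle\ge0$ and $p\in(-1,1]$. In this case, the future-pointing timelike cones of $L$ are the connected components of the cones $kA+mB^2>0$ contained in the future-pointing timelike cones $\mathcal{T}^a_x$ of $a$. (ii) $\langle b,b\rangle<0$ and $p\in(-1,0)$. In this case, the future-pointing timelike cones of $L$ are the regions of the cones $kA+mB^2>0$ lying both in the future-pointing timelike cones $\mathcal{T}^a_x$ of $a$ and in the half-space $B>0$.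
   Context: $\overset{\circ}{TM}=TM\setminus\{0\}$. A conic subbundle of $TM$ is a non-empty open submanifold $\mathcal{Q}\subset\overset{\circ}{TM}$ projecting onto all of $M$ and closed under $(x,\dot x)\mapsto(x,\lambda\dot x)$, $\lambda>0$. A pseudo-Finsler structure is a smooth function $L:\mathcal{A}\to\mathbb{R}$ on a conic subbundle $\mathcal{A}$ with $L(x,\lambda\dot x)=\lambda^2L(x,\dot x)$ for $\lambda>0$ and $g_{ij}=\frac12\frac{\partial^2L}{\partial\dot x^i\partial\dot x^j}$ nondegenerate on $\mathcal{A}$; $\mathcal{A}$ is the maximal subset of $\overset{\circ}{TM}$ with these properties. An $(\alpha,\beta)$-metric is by definition a pseudo-Finsler structure of the form $L=A\Psi(s)$ with $\Psi$ smooth on $s(\mathcal{A})$. ''The Kundt metric'' is an $(\alpha,\beta)$-metric with $\Psi(s)=(k+ms)^{p+1}s^{-p}$; in particular $\mathcal{A}$, the set where $L$ is defined and smooth with nondegenerate $g$, is assumed to be a conic subbundle (so it has points over every $x\in M$). Real powers are taken of positive bases, so $A>0$, $s>0$ (i.e. $B\neq0$) and $k+ms>0$ on $\mathcal{A}$, and $B^{-2p}$ means $(B^2)^{-p}$. $\langle b,b\rangle=a^{ij}b_ib_j$. The conditions $\langle b,b\rangle\ge0$, resp. $\langle b,b\rangle<0$, are understood to hold on all of $M$, and the 1-form $b$ is understood to satisfy one of these two (either non-spacelike everywhere, or spacelike everywhere). $L$ defines a Finsler spacetime structure if there exists a connected conic subbundle $\mathcal{T}\subset\mathcal{A}$ with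 connected fibers $\mathcal{T}_x=\mathcal{T}\cap T_xM$ such that on each $\mathcal{T}_x$: $L>0$, $g$ has signature $(+,-,-,-)$, and $L$ can be continuously extended as $0$ to the boundary $\partial\mathcal{T}_x$ (in $T_xM$). The $\mathcal{T}_x$ are the future-pointing timelike cones of $L$. Since $L$ depends only on $B^2$, in (ii) the sign of $B$ on $\mathcal{T}_x$ is a choice, and $B>0$ is chosen. Standing assumption: at each $x$, $\mathcal{T}_x$ and the future-pointing timelike cone $\mathcal{T}^a_x$ of $a$ (one of the two connected components of $\{\dot x\in T_xM:A>0\}$, according to a time orientation of $a$) have non-empty intersection. *)

(* Defs.v *)
From HB Require Import structures.
From mathcomp Require Import all_boot all_order all_algebra.
From mathcomp Require Import all_classical all_reals all_analysis.
Set Implicit Arguments.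
Unset Strict Implicit.
Unset Printing Implicit Defensive.
Import Order.TTheory GRing.Theory Num.Theory numFieldNormedType.Exports.
Local Open Scope classical_set_scope.
Local Open Scope ring_scope.

(* [Ck n U f]: f is C^n on the open set U.  In finite dimension, f is C^(n+1)
   iff it is differentiable and each directional derivative is C^n. *)
Fixpoint Ck (R : realType) (V W : normedModType R) (n : nat) (U : set V)
    (f : V -> W) : Prop :=
  match n with
  | 0%N => forall x, U x -> {for x, continuous f}
  | n'.+1 => (forall x, U x -> differentiable f x) /\
             (forall v, Ck n' U (fun x => 'D_v f x))
  end.

Definition smooth_on (R : realType) (V W : normedModType R) (U : set V)
    (f : V -> W) : Prop := forall n, Ck n U f.

(* A smooth manifold given by a smooth atlas.  [phi i] and [psi i] are total
   functions, meaningful on [dom i] and on [phi i @` dom i] only.  [chart_at x]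
   is a chosen chart around x, used to coordinatize the tangent space at x. *)
Record manifold (R : realType) (d : nat) := Manifold {
  points :> topologicalType;
  chart : Type;
  dom : chart -> set points;
  phi : chart -> points -> 'rV[R]_d;
  psi : chart -> 'rV[R]_d -> points;
  chart_at : points -> chart;
  manifold_hausdorff : hausdorff_space points;
  manifold_second_countable : @second_countable points;
  dom_open : forall i, open (dom i);
  cod_open : forall i, open (phi i @` dom i);
  phiK : forall i x, dom i x -> psi i (phi i x) = x;
  phi_continuous : forall i x, dom i x -> {for x, continuous (phi i)};
  psi_continuous : forall i y, (phi i @` dom i) y ->
    {for y, continuous (psi i)};
  transition_smooth : forall i j,
    smooth_on (phi i @` (dom i `&` dom j)) (phi j \o psi i);
  dom_chart_at : forall x, dom (chart_at x) x
}.

Section TangentBundle.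
Context {R : realType} {d : nat} (M : manifold R d).

(* T_xM is 'rV[R]_d, a vector being identified with its coordinates in the
   chart [chart_at x].  The topology of TM is not the product one; it is
   defined below. *)
Definition TM : Type := (M * 'rV[R]_d)%type.

HB.instance Definition _ := Choice.on TM.

Definition tvec (x : M) (v : 'rV[R]_d) : TM := (x, v).

Definition cod (i : chart M) : set 'rV[R]_d := phi i @` dom i.

(* Its rows are the coordinate vectors of the chart i at the point [psi i y],
   as elements of T_(psi i y)M. *)
Definition frame (i : chart M) (y : 'rV[R]_d) : 'M[R]_d :=
  jacobian (phi (chart_at (psi i y)) \o psi i) y.

(* The natural chart of TM associated with i, as a parametrization from
   cod i x R^d. *)
Definition tparam (i : chart M) (yw : 'rV[R]_d * 'rV[R]_d) : TM :=
  tvec (psi i yw.1) (yw.2 *m frame i yw.1).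

Definition tpre (i : chart M) (Q : set TM) : set ('rV[R]_d * 'rV[R]_d) :=
  [set yw | cod i yw.1 /\ Q (tparam i yw)].

Definition openTM (Q : set TM) : Prop := forall i, open (tpre i Q).

Lemma openTM_T : openTM setT.
Proof.
move=> i; have -> : tpre i setT = fst @^-1` (cod i).
  by apply/seteqP; split => [yw []//|yw /=]; split.
by apply: open_comp; [move=> x _; exact: cvg_fst|exact: cod_open].
Qed.

Lemma openTM_I : setI_closed openTM.
Proof.
move=> P Q oP oQ i; have -> : tpre i (P `&` Q) = tpre i P `&` tpre i Q.
  by apply/seteqP; split => yw /=; [case=> ? []|case=> -[? ?] []].
exact: openI.
Qed.

Lemma openTM_bigU (I : Type) (f : I -> set TM) :
  (forall j, openTM (f j)) -> openTM (\bigcup_j f j).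
Proof.
move=> of_ i; have -> : tpre i (\bigcup_j f j) = \bigcup_j tpre i (f j).
  apply/seteqP; split => yw /=; first by case=> c [j _ fj]; exists j.
  by case=> j _ [c fj]; split => //; exists j.
by apply: bigcup_open => j _; exact: of_.
Qed.

HB.instance Definition _ :=
  isOpenTopological.Build TM openTM_T openTM_I openTM_bigU.

Definition fiber (Q : set TM) (x : M) : set 'rV[R]_d :=
  [set v | Q (tvec x v)].

Definition smooth_TM (Q : set TM) (F : TM -> R) : Prop :=
  forall i, smooth_on (tpre i Q) (F \o tparam i : _ -> R^o).

Definition conic_subbundle (Q : set TM) : Prop :=
  [/\ Q !=set0 /\ open Q,
      forall x v, Q (tvec x v) -> v != 0,
      forall x, fiber Q x !=set0 &
      forall x v (l : R), 0 < l -> Q (tvec x v) -> Q (tvec x (l *: v))].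

(* There is a nowhere vanishing smooth d-form: [omega x] is its value on the
   standard basis of T_xM. *)
Definition orientable : Prop :=
  exists omega : M -> R, (forall x, omega x != 0) /\
    forall i, smooth_on (cod i)
      (fun y => omega (psi i y) * \det (frame i y) : R^o).

(* A bilinear form on T_xM is a matrix, a covector is a column, both in the
   coordinates of T_xM; [frame] converts them to the components in a chart. *)
Definition smooth_bilinear (a : M -> 'M[R]_d) : Prop :=
  forall i, smooth_on (cod i)
    (fun y => frame i y *m a (psi i y) *m (frame i y)^T).

Definition smooth_form (b : M -> 'cV[R]_d) : Prop :=
  forall i, smooth_on (cod i) (fun y => frame i y *m b (psi i y)).

(* signature (+,-,...,-), by congruence; this makes Q symmetric *)
Definition lorentzian (Q : 'M[R]_d) : Prop :=
  exists2 P : 'M[R]_d, P \in unitmx &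
    P *m Q *m P^T = \matrix_(i, j) (if i == j then
                                      if val i == 0%N then 1 else -1
                                    else 0).

Definition lorentzian_metric (a : M -> 'M[R]_d) : Prop :=
  smooth_bilinear a /\ forall x, lorentzian (a x).

Definition Aform (a : M -> 'M[R]_d) (xv : TM) : R :=
  (xv.2 *m a xv.1 *m xv.2^T) 0 0.

Definition Bform (b : M -> 'cV[R]_d) (xv : TM) : R := (xv.2 *m b xv.1) 0 0.

(* <b,b> = a^{ij} b_i b_j *)
Definition form_norm (a : M -> 'M[R]_d) (b : M -> 'cV[R]_d) (x : M) : R :=
  ((b x)^T *m invmx (a x) *m b x) 0 0.

Definition is_component (T : topologicalType) (S K : set T) : Prop :=
  exists2 v, S v & K = connected_component S v.

(* A choice, at every x, of one of the components of the cone A > 0, which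
   locally contains a continuous vector field. *)
Definition time_orientation (a : M -> 'M[R]_d) (Ta : set TM) : Prop :=
  (forall x, is_component (fiber [set xv | 0 < Aform a xv] x) (fiber Ta x)) /\
  (forall x0, exists (U : set M) (X : M -> 'rV[R]_d),
    [/\ open U, U x0,
        forall x, U x -> Ta (tvec x (X x)) &
        forall x, U x -> {for x, continuous (fun y => tvec y (X y))}]).

(* g_ij = 1/2 d^2 L / dv^i dv^j *)
Definition fundamental (L : TM -> R) (xv : TM) : 'M[R]_d :=
  \matrix_(i, j) (2^-1 *
    'D_(delta_mx 0 i)
      (fun u => 'D_(delta_mx 0 j) (fun w => L (tvec xv.1 w) : R^o) u : R^o)
      xv.2).

(* [D] is the set where the expression L makes sense. *)
Definition pseudo_finsler (L : TM -> R) (D Q : set TM) : Prop :=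
  [/\ conic_subbundle Q,
      Q `<=` D,
      smooth_TM Q L,
      forall x v (l : R), 0 < l -> Q (tvec x v) ->
        L (tvec x (l *: v)) = l ^+ 2 * L (tvec x v) &
      forall xv, Q xv -> fundamental L xv \in unitmx].

Definition maximal_pseudo_finsler (L : TM -> R) (D Q : set TM) : Prop :=
  pseudo_finsler L D Q /\ forall Q', pseudo_finsler L D Q' -> Q' `<=` Q.

(* [T] makes L, defined on Q, a Finsler spacetime structure. *)
Definition finsler_spacetime_cones (L : TM -> R) (Q T : set TM) : Prop :=
  [/\ conic_subbundle T /\ T `<=` Q,
      connected T /\ (forall x, connected (fiber T x)),
      forall xv, T xv -> 0 < L xv,
      forall xv, T xv -> lorentzian (fundamental L xv) &
      forall x, {within closure (fiber T x), continuous
        (fun v => if v \in fiber T x then L (tvec x v) else 0)}].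

Definition compatible_cones (Ta T : set TM) : Prop :=
  forall x, (fiber T x `&` fiber Ta x) !=set0.

Definition alpha_beta (a : M -> 'M[R]_d) (b : M -> 'cV[R]_d) (Psi : R -> R)
    (xv : TM) : R :=
  Aform a xv * Psi (Bform b xv ^+ 2 / Aform a xv).

Definition kundt_psi (p k m s : R) : R :=
  (k + m * s) `^ (p + 1) * s `^ (- p).

Definition kundt (a : M -> 'M[R]_d) (b : M -> 'cV[R]_d) (p k m : R)
  : TM -> R := alpha_beta a b (kundt_psi p k m).

(* real powers are taken of positive bases only *)
Definition kundt_dom (a : M -> 'M[R]_d) (b : M -> 'cV[R]_d) (k m : R)
  : set TM :=
  [set xv | [/\ 0 < Aform a xv, Bform b xv != 0 &
                0 < k + m * (Bform b xv ^+ 2 / Aform a xv)]].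

Definition kundt_cone (a : M -> 'M[R]_d) (b : M -> 'cV[R]_d) (k m : R)
  : set TM := [set xv | 0 < k * Aform a xv + m * Bform b xv ^+ 2].

Lemma kundtE (a : M -> 'M[R]_d) (b : M -> 'cV[R]_d) (p k m : R) (xv : TM) :
  kundt_dom a b k m xv ->
  kundt a b p k m xv = (Bform b xv ^+ 2) `^ (- p) *
    (k * Aform a xv + m * Bform b xv ^+ 2) `^ (p + 1).
Proof.
rewrite /kundt_dom /kundt /alpha_beta /kundt_psi /=.
move: (Aform a xv) (Bform b xv) => A B [A0 B0 C0].
have sq : 0 < B ^+ 2 by rewrite exprn_even_gt0.
have -> : k * A + m * B ^+ 2 = A * (k + m * (B ^+ 2 / A)).
  by rewrite mulrDr [A * k]mulrC (mulrCA A) (mulrCA A) divff ?mulr1// gt_eqF.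
have -> : (B ^+ 2) `^ (- p) = A `^ (- p) * (B ^+ 2 / A) `^ (- p).
  rewrite -powRM ?ltW ?divr_gt0//.
  by rewrite (mulrCA A) divff ?mulr1// gt_eqF.
move: C0; set s := _ / A; set C := k + _ => C0.
rewrite [(A * C) `^ _]powRM ?ltW// [RHS]mulrACA -powRD.
  by rewrite addrA addNr add0r powRr1 ?ltW// [X in _ * X]mulrC.
by rewrite (gt_eqF A0) implybT.
Qed.

End TangentBundle.

(* Main.v *)
Require Import Defs.
From HB Require Import structures.
From mathcomp Require Import all_boot all_order all_algebra.
From mathcomp Require Import all_classical all_reals all_analysis.
From mathcomp Require Import ring lra.
Set Implicit Arguments.
Unset Strict Implicit.
Unset Printing Implicit Defensive.
Import Order.TTheory GRing.Theory Num.Theory numFieldNormedType.Exports.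
Local Open Scope classical_set_scope.
Local Open Scope ring_scope.

(* Fix a point x, write A, B, C = k A + m B^2 for the values of the forms at a
   vector v of T_xM and n for the norm <b,b>; on its domain L is
   (B^2)^(-p) C^(p+1), and with e = a v - (A/B) b its fundamental tensor is
     (L/C) [(p+1) k a + (m - p k A/B^2) b b + (2 p (p+1) k^2/C) e e].
   Completing v by an a-orthogonal vector u, the Gram determinant of the
   fundamental tensor on (v, u) is bounded, through the Cauchy-Schwarz
   inequality on the (definite) orthogonal of v, by a negative multiple of
     k (1-p) (B^2 - n A) + n C,
   with equality when u is the projection of the dual of b; the sign of this
   expression decides whether the signature is Lorentzian.

   The fibre T_x is open, and also closed in {A > 0, B != 0, C > 0}, because L is
   positive there but tends to 0 at the boundary of T_x.  Following from a vector
   of T_x a straight line inside ker b, respectively a line in the direction of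
   the dual of b, one reaches A = 0, C = 0 or B = 0 without leaving T_x, and the
   behaviour of L there gives the conditions on m, k and p.  Conversely, when
   k > 0 > m, the set {C > 0} inside a time cone of a is a convex cone, hence
   connected, and the openness of TM -> M makes the union over x connected. *)

(** * Bilinear forms of Lorentzian signature *)

Section LorentzianForms.
Context {R : realType}.

(** Case (i) needs [b] nowhere zero and, when p = 1, n nowhere zero; neither is stated. Both come
    from [Adom]: it has points over every x, with B != 0 there, and its fundamental tensor is
    invertible, whereas for p = 1 and n = 0 that tensor has an explicit kernel. [Adom] also gives a
    vector with C > 0 over every x, which makes the fibres of the candidate cones non-empty; its
    maximality places the candidate inside it, once the candidate is itself shown to carry a
    pseudo-Finsler structure. For the converse, the hard boundary vectors are those with B = 0,
    where (B^2)^(-p) is unbounded if p > 0. If n >= 0, the metric is negative semidefinite on ker b,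
    so near such a vector A is at most a multiple of |B|, and L at most a multiple of |B|^(1-p).
    This decays for p < 1; the exponent p = 1 survives because n > 0 gives the sharper bound n A <=
    B^2. If n < 0, ker b contains timelike vectors and cuts the cone, and only a positive exponent
    -p makes L vanish there. *)

Definition bil n (q : 'M[R]_n) (u v : 'rV[R]_n) : R := (u *m q *m v^T) 0 0.

Definition lin n (c : 'cV[R]_n) (u : 'rV[R]_n) : R := (u *m c) 0 0.

Lemma bilDl n (q : 'M[R]_n) u v w : bil q (u + v) w = bil q u w + bil q v w.
Proof. by rewrite /bil !mulmxDl mxE. Qed.

Lemma bilDr n (q : 'M[R]_n) u v w : bil q w (u + v) = bil q w u + bil q w v.
Proof. by rewrite /bil linearD mulmxDr mxE. Qed.

Lemma bilZl n (q : 'M[R]_n) t u v : bil q (t *: u) v = t * bil q u v.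
Proof. by rewrite /bil -!scalemxAl mxE. Qed.

Lemma bilZr n (q : 'M[R]_n) t u v : bil q u (t *: v) = t * bil q u v.
Proof. by rewrite /bil linearZ -scalemxAr mxE. Qed.

Lemma bilNl n (q : 'M[R]_n) u v : bil q (- u) v = - bil q u v.
Proof. by rewrite -scaleN1r bilZl mulN1r. Qed.

Lemma bilNr n (q : 'M[R]_n) u v : bil q u (- v) = - bil q u v.
Proof. by rewrite -scaleN1r bilZr mulN1r. Qed.

Lemma bil0l n (q : 'M[R]_n) u : bil q 0 u = 0.
Proof. by rewrite /bil !mul0mx mxE. Qed.

Lemma bil0r n (q : 'M[R]_n) u : bil q u 0 = 0.
Proof. by rewrite /bil linear0 mulmx0 mxE. Qed.

Lemma bilC n (q : 'M[R]_n) u v : q^T = q -> bil q u v = bil q v u.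
Proof.
move=> qT; rewrite /bil -[in LHS](trmxK (u *m q *m v^T)) mxE.
by rewrite !trmx_mul trmxK qT mulmxA.
Qed.

Lemma linD n (c : 'cV[R]_n) u v : lin c (u + v) = lin c u + lin c v.
Proof. by rewrite /lin mulmxDl mxE. Qed.

Lemma linZ n (c : 'cV[R]_n) t u : lin c (t *: u) = t * lin c u.
Proof. by rewrite /lin -scalemxAl mxE. Qed.

Lemma linN n (c : 'cV[R]_n) u : lin c (- u) = - lin c u.
Proof. by rewrite -scaleN1r linZ mulN1r. Qed.

Definition bilE := (bilDl, bilDr, bilNl, bilNr, bilZl, bilZr, linD, linN, linZ).

Lemma bil_addq n (q r : 'M[R]_n) u v : bil (q + r) u v = bil q u v + bil r u v.
Proof. by rewrite /bil mulmxDr mulmxDl mxE. Qed.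

Lemma bil_scaleq n (q : 'M[R]_n) t u v : bil (t *: q) u v = t * bil q u v.
Proof. by rewrite /bil -scalemxAr -scalemxAl mxE. Qed.

Lemma bil_square n (c : 'cV[R]_n) u v : bil (c *m c^T) u v = lin c u * lin c v.
Proof.
rewrite /bil /lin mulmxA -mulmxA -trmx_mul mxE big_ord1; congr (_ * _).
by rewrite mxE.
Qed.

Lemma bil_congr n (P q : 'M[R]_n) u v :
  bil (P *m q *m P^T) u v = bil q (u *m P) (v *m P).
Proof. by rewrite /bil trmx_mul !mulmxA. Qed.

Lemma lin_delta n (c : 'cV[R]_n) i : lin c (delta_mx 0 i) = c i 0.
Proof. by rewrite /lin -rowE mxE. Qed.

Lemma bil_delta n (q : 'M[R]_n) u i :
  bil q u (delta_mx 0 i) = (u *m q) 0 i.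
Proof. by rewrite /bil trmx_delta -colE mxE. Qed.

Definition minkowski n : 'M[R]_n :=
  \matrix_(i, j) (if i == j then if val i == 0%N then 1 else -1 else 0).

Lemma bil_minkowski n (u v : 'rV[R]_n.+1) :
  bil (minkowski n.+1) u v =
  u 0 0 * v 0 0 - \sum_i u 0 (lift 0 i) * v 0 (lift 0 i).
Proof.
have e j : (u *m minkowski n.+1) 0 j = u 0 j * minkowski n.+1 j j.
  rewrite mxE (bigD1 j)//= big1 ?addr0// => i /negPf ij.
  by rewrite mxE ij mulr0.
rewrite /bil mxE big_ord_recl /= e !mxE /= mulr1 -sumrN; congr (_ + _).
by apply: eq_bigr => i _; rewrite e !mxE eqxx /= mulrN1 mulNr.
Qed.

Lemma lorentzian_sym n (Q : 'M[R]_n) : lorentzian Q -> Q^T = Q.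
Proof.
case=> P uP; rewrite -/(minkowski n) => e.
have : (P *m Q *m P^T)^T = P *m Q *m P^T.
  rewrite e; apply/matrixP => i j; rewrite !mxE eq_sym.
  by case: eqVneq => // ->.
rewrite !trmx_mul trmxK mulmxA => /(congr1 (fun N => N *m invmx P^T)).
rewrite !mulmxK ?unitmx_tr// => /(congr1 (fun N => invmx P *m N)).
by rewrite !mulKmx.
Qed.

Lemma lorentzian_unit n (Q : 'M[R]_n) : lorentzian Q -> Q \in unitmx.
Proof.
case=> P uP; rewrite -/(minkowski n) => e.
suff : P *m Q *m P^T \in unitmx by rewrite !unitmx_mul => /andP[/andP[]].
rewrite e; suff /mulmx1_unit[] : minkowski n *m minkowski n = 1%:M by [].
apply/matrixP => i j; rewrite !mxE (bigD1 i)//= big1 => [|k ki].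
  rewrite !mxE eqxx; case: eqP => _; case: eqP => _ /=;
    by rewrite ?(mulr0, addr0, mul1r, mulrNN).
by rewrite !mxE eq_sym (negPf ki) mul0r.
Qed.

Lemma minkowski_orth_lt0 n (u v : 'rV[R]_n.+1) :
  0 < bil (minkowski n.+1) v v -> bil (minkowski n.+1) v u = 0 -> u != 0 ->
  bil (minkowski n.+1) u u < 0.
Proof.
rewrite !bil_minkowski => v0 /eqP; rewrite subr_eq0 => /eqP vu u0.
set S := \sum_i u 0 (lift 0 i) * _; set T := \sum_i _ * _ in v0.
(* By orthogonality [v 0 0 * u 0 0] is the scalar product of the spatial parts. Expanding W then
   shows that [v 0 0 ^+ 2] times the square of u is minus [u 0 0 ^+ 2] times the square of v, minus
   W. *)
pose W := \sum_i (v 0 0 * u 0 (lift 0 i) - u 0 0 * v 0 (lift 0 i)) ^+ 2.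
have W0 : 0 <= W by apply: sumr_ge0 => i _; exact: sqr_ge0.
have S0 : 0 <= S by apply: sumr_ge0 => i _; rewrite -expr2 sqr_ge0.
have WE : W = v 0 0 ^+ 2 * S - 2 * (v 0 0 * u 0 0) ^+ 2 + u 0 0 ^+ 2 * T.
  rewrite [(v 0 0 * u 0 0) ^+ 2]expr2 {2}vu !mulr_sumr -sumrB -big_split /=.
  by apply: eq_bigr => i _; ring.
have v00 : 0 < v 0 0 ^+ 2.
  rewrite expr2; have T0 : 0 <= T.
    by apply: sumr_ge0 => i _; rewrite -expr2 sqr_ge0.
  lra.
have [u00|u00] := eqVneq (u 0 0) 0.
  rewrite u00 mul0r sub0r oppr_lt0 lt_neqAle S0 andbT eq_sym.
  apply: contra u0 => /eqP Se; apply/eqP/rowP => j; rewrite mxE.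
  case: (unliftP 0 j) => [i ->|->//].
  have /psumr_eq0P : forall i : 'I_n, true -> 0 <= u 0 (lift 0 i) * u 0 (lift 0 i).
    by move=> k _; rewrite -expr2 sqr_ge0.
  by move=> /(_ Se) /(_ i isT) /eqP; rewrite mulf_eq0 orbb => /eqP.
have u2 : 0 < u 0 0 ^+ 2 by rewrite exprn_even_gt0.
have : 0 < u 0 0 ^+ 2 * (v 0 0 * v 0 0 - T) by rewrite mulr_gt0.
have : v 0 0 ^+ 2 * (u 0 0 * u 0 0 - S) =
    u 0 0 ^+ 2 * T - v 0 0 ^+ 2 * u 0 0 ^+ 2 - W.
  by rewrite WE; ring.
move=> e h; rewrite -(pmulr_rlt0 _ v00) e; move: h; rewrite mulrBr.
by move: W0; rewrite -expr2; nra.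
Qed.

Lemma lorentzian_orth_lt0 n (Q : 'M[R]_n) u v :
  lorentzian Q -> 0 < bil Q v v -> bil Q v u = 0 -> u != 0 -> bil Q u u < 0.
Proof.
case: n Q u v => [|n] Q u v; first by rewrite (thinmx0 u) eqxx.
case=> P uP; rewrite -/(minkowski n.+1) => e.
have be w z : bil Q w z = bil (minkowski n.+1) (w *m invmx P) (z *m invmx P).
  by rewrite -e bil_congr !mulmxKV.
rewrite !be => v0 vu u0; apply: minkowski_orth_lt0 v0 vu _.
by apply: contra u0 => /eqP /(congr1 (mulmx^~ P)); rewrite mulmxKV// mul0mx => ->.
Qed.

Lemma orth_split n (Q : 'M[R]_n) (u v : 'rV[R]_n) : bil Q v v != 0 ->
  bil Q v (u - (bil Q v u / bil Q v v) *: v) = 0.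
Proof. by move=> v0; rewrite !bilE divfK ?subrr. Qed.

Lemma lorentzian_orth_le0 n (Q : 'M[R]_n) u v :
  lorentzian Q -> 0 < bil Q v v -> bil Q v u = 0 -> bil Q u u <= 0.
Proof.
move=> lQ v0 vu; have [->|u0] := eqVneq u 0; first by rewrite bil0l.
exact/ltW/(lorentzian_orth_lt0 lQ v0 vu).
Qed.

(** The component of u orthogonal to v has nonpositive square. *)
Lemma reverse_cauchy_schwarz n (Q : 'M[R]_n) u v :
  lorentzian Q -> 0 < bil Q v v -> bil Q v v * bil Q u u <= bil Q v u ^+ 2.
Proof.
move=> lQ v0; have v0' : bil Q v v != 0 by rewrite gt_eqF.
have := lorentzian_orth_le0 lQ v0 (orth_split u v0').
rewrite !bilE (bilC u v (lorentzian_sym lQ)) => h.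
have -> : bil Q v u ^+ 2 = bil Q v v * (bil Q v u ^+ 2 / bil Q v v).
  by rewrite mulrC divfK.
by rewrite ler_pM2l// -subr_le0; apply: le_trans h; rewrite le_eqVlt; apply/orP;
   left; apply/eqP; field.
Qed.

(** On the orthogonal of v the form is negative semidefinite, so the usual argument applies:
    subtract from u its component along w. *)
Lemma orth_cauchy_schwarz n (Q : 'M[R]_n) u v w :
  lorentzian Q -> 0 < bil Q v v -> bil Q v u = 0 -> bil Q v w = 0 ->
  bil Q u w ^+ 2 <= bil Q u u * bil Q w w.
Proof.
move=> lQ v0 vu vw; have [->|w0] := eqVneq w 0.
  by rewrite !bil0r expr0n mulr0.
have ww := lorentzian_orth_lt0 lQ v0 vw w0.
have ww' : bil Q w w != 0 by rewrite lt_eqF.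
have : bil Q v (u - (bil Q w u / bil Q w w) *: w) = 0.
  by rewrite !bilE vu vw mulr0 subrr.
move/(lorentzian_orth_le0 lQ v0).
rewrite !bilE (bilC w u (lorentzian_sym lQ)) => h.
have -> : bil Q u w ^+ 2 = (bil Q u w ^+ 2 / bil Q w w) * bil Q w w.
  by rewrite divfK.
rewrite ler_nM2r// -subr_le0; apply: le_trans h; rewrite le_eqVlt; apply/orP.
by left; apply/eqP; field.
Qed.

(** One Gram-Schmidt step with the first basis vector as pivot. That P fixes this vector lets
    [lorentzian_criterion] keep v along the first axis. *)
Lemma block_diagonalize n (S : 'M[R]_(1 + n)) : S^T = S -> S 0 0 != 0 ->
  exists2 P : 'M[R]_(1 + n),
    P \in unitmx /\ row_mx (1%:M : 'M[R]_1) 0 *m P = row_mx (1%:M : 'M[R]_1) 0 &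
  exists S' : 'M[R]_n, P *m S *m P^T = block_mx (S 0 0)%:M 0 0 S'.
Proof.
move=> ST S00; pose c := dlsubmx S.
pose P : 'M[R]_(1 + n) := block_mx 1%:M 0 (- (S 0 0)^-1 *: c) 1%:M.
exists P.
  split; first by rewrite unitmxE det_lblock !det1 mulr1 unitr1.
  by rewrite mul_row_block !mulmx0 !mul0mx !addr0 mul1mx.
have Sul : ulsubmx S = (S 0 0)%:M.
  by rewrite [LHS]mx11_scalar !mxE lshift0.
have Sur : ursubmx S = c^T by rewrite /c -[in RHS]ST -trmx_ursub trmxK.
exists (drsubmx S - (S 0 0)^-1 *: (c *m c^T)).
rewrite -[S in LHS]submxK Sul Sur -/c /P tr_block_mx !mulmx_block !trmx1 !trmx0.
rewrite !(mul0mx, mulmx0, mul1mx, mulmx1, addr0, add0r).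
rewrite linearZ /= -!scalemxAr -!scalemxAl !mul_scalar_mx !mul_mx_scalar.
rewrite !scalerA !mulNr mulVf// !scaleN1r !addNr mul0mx scaler0 add0r.
by rewrite addrC scaleNr.
Qed.

Lemma block_diagonalize_sym n (P S : 'M[R]_(1 + n)) (D : 'M[R]_1) (S' : 'M[R]_n) :
  S^T = S -> P *m S *m P^T = block_mx D 0 0 S' -> S'^T = S'.
Proof.
move=> ST e; have : (block_mx D 0 0 S')^T = block_mx D 0 0 S'.
  by rewrite -e !trmx_mul trmxK ST mulmxA.
by rewrite tr_block_mx => /eq_block_mx[].
Qed.

Lemma bil_block0 n (s : 'M[R]_1) (S : 'M[R]_n) x y z w :
  bil (block_mx s 0 0 S) (row_mx x z) (row_mx y w) = bil s x y + bil S z w.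
Proof.
rewrite /bil tr_row_mx mul_row_block !mulmx0 addr0 add0r mul_row_col.
by rewrite mxE.
Qed.

Lemma unitmx_block0 n (c : R) (T : 'M[R]_n) : c != 0 -> T \in unitmx ->
  (block_mx (c%:M : 'M[R]_1) 0 0 T : 'M[R]_(1 + n)) \in unitmx.
Proof.
move=> c0 uT; rewrite unitmxE det_ublock unitrM -!unitmxE uT andbT.
by rewrite unitmxE det_scalar expr1 unitfE.
Qed.

Lemma posdef_orthonormal n (S : 'M[R]_n) :
  S^T = S -> (forall u, u != 0 -> 0 < bil S u u) ->
  exists2 P : 'M[R]_n, P \in unitmx & P *m S *m P^T = 1%:M.
Proof.
elim: n S => [|n IH] S ST S0.
  by exists 1%:M; [exact: unitmx1|apply/matrixP => -[]].
have S00 : 0 < S 0 0.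
  have -> : S 0 0 = bil S (delta_mx 0 0) (delta_mx 0 0).
    by rewrite bil_delta -rowE mxE.
  by apply: S0; apply/eqP => /rowP/(_ 0)/eqP; rewrite !mxE oner_eq0.
have [P [uP _] [S' e]] := block_diagonalize ST (lt0r_neq0 S00).
have bS x z : bil S (row_mx x z *m P) (row_mx x z *m P) =
    bil (S 0 0)%:M x x + bil S' z z by rewrite -bil_congr e bil_block0.
have [||P' uP' e'] := IH S'.
- exact: block_diagonalize_sym ST e.
- move=> u u0; have := bS 0 u; rewrite bil0l add0r => <-; apply: S0.
  apply: contra u0 => /eqP/(congr1 (mulmx^~ (invmx P))); rewrite mulmxK// mul0mx.
  by rewrite -row_mx0 => /eq_row_mx[_ ->].
have sq0 : Num.sqrt (S 0 0) != 0 by rewrite gt_eqF// sqrtr_gt0.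
exists (block_mx (Num.sqrt (S 0 0))^-1%:M 0 0 P' *m P).
  by rewrite unitmx_mul uP andbT; apply: unitmx_block0; rewrite // invr_eq0.
set B := block_mx _ _ _ _.
have -> : B *m P *m S *m (B *m P)^T = B *m (P *m S *m P^T) *m B^T.
  by rewrite trmx_mul !mulmxA.
rewrite e /B tr_block_mx !mulmx_block !trmx0 !(mul0mx, mulmx0, addr0, add0r).
rewrite e' tr_scalar_mx -!scalar_mxM.
have -> : (Num.sqrt (S 0 0))^-1 * S 0 0 * (Num.sqrt (S 0 0))^-1 = 1.
  by rewrite -{2}(sqr_sqrtr (ltW S00)) expr2; field.
by rewrite -(scalar_mx_block 1 n 1).
Qed.

Lemma lorentzian_block n (s : R) (S : 'M[R]_n) (T : 'M[R]_n) :
  0 < s -> T \in unitmx -> T *m S *m T^T = - 1%:M ->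
  lorentzian (block_mx (s%:M : 'M[R]_1) 0 0 S : 'M[R]_(1 + n)).
Proof.
move=> s0 uT e.
have sq0 : Num.sqrt s != 0 by rewrite gt_eqF// sqrtr_gt0.
exists (block_mx (Num.sqrt s)^-1%:M 0 0 T : 'M[R]_(1 + n)).
  by apply: unitmx_block0; rewrite // invr_eq0.
rewrite tr_block_mx !mulmx_block !trmx0 !(mul0mx, mulmx0, addr0, add0r).
rewrite e tr_scalar_mx -!scalar_mxM.
have -> : (Num.sqrt s)^-1 * s * (Num.sqrt s)^-1 = 1.
  by rewrite -{2}(sqr_sqrtr (ltW s0)) expr2; field.
apply/matrixP => i j; case: (split_ordP i) => {}i ->; case: (split_ordP j) => {}j ->;
  rewrite ?(block_mxEul, block_mxEur, block_mxEdl, block_mxEdr) !mxE.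
- by rewrite !ord1.
- by rewrite -val_eqE !ord1.
- by rewrite -val_eqE !ord1.
- by rewrite -!val_eqE /= eqn_add2l; case: eqP => _; rewrite ?oppr0.
Qed.

Lemma lorentzian_congr n (P Q : 'M[R]_n) :
  P \in unitmx -> lorentzian (P *m Q *m P^T) -> lorentzian Q.
Proof.
move=> uP [T uT e]; exists (T *m P); first by rewrite unitmx_mul uT.
by rewrite -e trmx_mul !mulmxA.
Qed.

(** Converse of [lorentzian_orth_lt0]: in a basis starting along v, one Gram-Schmidt step leaves a
    negative definite block, which [posdef_orthonormal] normalizes. *)
Lemma lorentzian_criterion n (Q : 'M[R]_n) v :
  Q^T = Q -> 0 < bil Q v v ->
  (forall u, u != 0 -> bil Q v u = 0 -> bil Q u u < 0) -> lorentzian Q.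
Proof.
case: n Q v => [|n] Q v; first by rewrite (thinmx0 v) bil0l ltxx.
move=> QT v0 Qneg.
have vn0 : v != 0 by apply: contraTN v0 => /eqP ->; rewrite bil0l ltxx.
pose P0 : 'M[R]_(1 + n) := row_ebase v.
(* The rank normal form of the single row v provides an invertible matrix whose first row is
   proportional to v. *)
have [c c0 vE] : exists2 c, c != 0 & v = c *: (row_mx (1%:M : 'M[R]_1) 0 *m P0).
  have := mulmx_ebase v; rewrite rank_rV vn0 [col_ebase v]mx11_scalar.
  set c := col_ebase v 0 0; rewrite mul_scalar_mx -scalemxAl => e.
  exists c; first by apply: contra vn0 => /eqP c0; rewrite -e c0 scale0r.
  rewrite -[LHS]e; congr (_ *: (_ *m _)); apply/rowP => j; rewrite !mxE.
  case: (@split_ordP 1 n j) => i ->; last by rewrite !mxE.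
  by rewrite !mxE !ord1.
pose e0 : 'rV[R]_(1 + n) := row_mx (1%:M : 'M[R]_1) 0.
have uP0 : P0 \in unitmx by exact: row_ebase_unit.
pose S := P0 *m Q *m P0^T.
have bS : bil Q v v = c ^+ 2 * S 0 0.
  rewrite vE !bilE -bil_congr -/S expr2 mulrA; congr (_ * _).
  have -> : row_mx (1%:M : 'M[R]_1) 0 = delta_mx 0 0 :> 'rV[R]_(1 + n).
    apply/rowP => j; case: (@split_ordP 1 n j) => i ->;
    by rewrite ?(row_mxEl, row_mxEr) !mxE ?ord1.
  by rewrite bil_delta -rowE mxE.
have S00 : 0 < S 0 0.
  by move: v0; rewrite bS pmulr_rgt0// lt_neqAle sqr_ge0 eq_sym sqrf_eq0 c0.
have ST : S^T = S by rewrite /S !trmx_mul trmxK QT mulmxA.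
have [P [uP e0P] [S' e]] := block_diagonalize ST (lt0r_neq0 S00).
apply: (lorentzian_congr uP0); apply: (lorentzian_congr uP); rewrite e.
have [|u u0|T uT eT] := @posdef_orthonormal n (- S').
- by rewrite linearN /= (block_diagonalize_sym ST e).
- rewrite -scaleN1r bil_scaleq mulN1r oppr_gt0.
  have -> : bil S' u u = bil Q (row_mx 0 u *m P *m P0) (row_mx 0 u *m P *m P0).
    by rewrite -bil_congr -/S -bil_congr e bil_block0 bil0l add0r.
  apply: Qneg.
    apply: contra u0 => /eqP/(congr1 (mulmx^~ (invmx P0))).
    rewrite mulmxK// mul0mx => /(congr1 (mulmx^~ (invmx P))).
    by rewrite mulmxK// mul0mx -row_mx0 => /eq_row_mx[_ ->].
  rewrite vE bilZl -bil_congr -/S -{1}e0P -bil_congr e bil_block0.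
  by rewrite bil0r bil0l addr0 mulr0.
apply: (lorentzian_block S00 uT).
by rewrite -[S']opprK mulmxN mulNmx eT.
Qed.

End LorentzianForms.

(** * Functions of class C^n *)

Section DifferentiabilityClasses.
Context {R : realType}.
Implicit Types V W : normedModType R.

(** The differential is kept along with differentiability: the chain rule for [frame] has to equate
    differentials of maps that agree only near a point. *)
Lemma near_eq_is_diff V W (f g : V -> W) (x : V) :
  {near x, f =1 g} -> differentiable f x -> is_diff x g ('d f x).
Proof.
move=> fg df.
have gE : g \o shift x = cst (g x) + 'd f x +o_ (0 : V) id.
  apply/eqaddoP => e e0; have := diff_locally df => /eqaddoP /(_ e e0) fe.
  have sh : \forall h \near (0 : V), f (h + x) = g (h + x).
    by rewrite (near_shift x) /= sub0r; near=> y; rewrite /= subrK; near: y.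
  apply: filterS2 fe sh => h.
  by rewrite !fctE /= (nbhs_singleton fg) => + <-.
have dg : 'd g x = 'd f x :> (V -> W).
  by apply: diff_unique => //; exact: diff_continuous.
split => //; apply/diff_locallyP; split; rewrite dg //.
exact: diff_continuous.
Unshelve. all: by end_near. Qed.

Lemma near_open V (U : set V) x (P : V -> Prop) :
  open U -> U x -> (forall y, U y -> P y) -> \forall y \near x, P y.
Proof.
by move=> oU Ux UP; near=> y; apply: UP; near: y; exact: open_nbhs_nbhs.
Unshelve. all: by end_near. Qed.

Lemma Ck_eq V W n (U : set V) (f g : V -> W) :
  open U -> (forall x, U x -> f x = g x) -> Ck n U f -> Ck n U g.
Proof.
move=> oU; elim: n f g => [|n IH] f g fg /=.
  move=> cf x Ux; rewrite /prop_for /continuous_at -(fg _ Ux).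
  apply: cvg_trans (cf x Ux); apply: near_eq_cvg.
  exact: near_open oU Ux _.
case=> df cf; split=> [x Ux|v].
  by case: (near_eq_is_diff (near_open oU Ux fg) (df x Ux)).
apply: IH (cf v) => x Ux; apply: near_eq_derive.
exact: near_open oU Ux _.
Qed.

Lemma Ck_sub V W n (U U' : set V) (f : V -> W) :
  U' `<=` U -> Ck n U f -> Ck n U' f.
Proof.
move=> UU; elim: n f => [|n IH] f /=; first by move=> cf x /UU; exact: cf.
by case=> df cf; split=> [x /UU|v]; [exact: df|exact: IH].
Qed.

Lemma CkS V W n (U : set V) (f : V -> W) : Ck n.+1 U f -> Ck n U f.
Proof.
elim: n f => [|n IH] f [df cf].
  by move=> x Ux; apply/differentiable_continuous/df.
by split=> // v; exact: IH.
Qed.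

Lemma Ck_cst V W n (U : set V) (c : W) : Ck n U (cst c : V -> W).
Proof.
elim: n c => [|n IH] c; first by move=> x _; exact: cst_continuous.
split=> [x _|v]; first exact: differentiable_cst.
have -> : (fun x => 'D_v (cst c : V -> W) x) = cst 0.
  by apply/funext => x; rewrite derive_cst.
exact: IH.
Qed.

Lemma smooth_on_linear V W (U : set V) (f : {linear V -> W}) :
  continuous f -> smooth_on U f.
Proof.
move=> cf [|n]; first by move=> x _; exact: cf.
split=> [x _|v]; first exact: linear_differentiable.
have -> : (fun x => 'D_v f x) = cst (f v).
  apply/funext => x; rewrite deriveE; last exact: linear_differentiable.
  by rewrite diff_lin.
exact: Ck_cst.
Qed.

Lemma Ck_add V W n (U : set V) (f g : V -> W) : open U ->
  Ck n U f -> Ck n U g -> Ck n U (f \+ g).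
Proof.
move=> oU; elim: n f g => [|n IH] f g.
  by move=> cf cg x Ux; apply: cvgD; [exact: cf|exact: cg].
move=> [df cf] [dg cg]; split=> [x Ux|v].
  by apply: differentiableD; [exact: df|exact: dg].
apply: (@Ck_eq _ _ _ _ ('D_v f \+ 'D_v g)) => //; last first.
  by apply: IH; [exact: cf|exact: cg].
move=> x Ux; apply/esym/deriveD; apply: diff_derivable; [exact: df|exact: dg].
Qed.

Lemma Ck_mul V n (U : set V) (f g : V -> R^o) : open U ->
  Ck n U f -> Ck n U g -> Ck n U (fun x => f x * g x : R^o).
Proof.
move=> oU; elim: n f g => [|n IH] f g.
  by move=> cf cg x Ux; apply: cvgM; [exact: cf|exact: cg].
move=> Cf Cg; have [df cf] := Cf; have [dg cg] := Cg; split=> [x Ux|v].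
  by apply: differentiableM; [exact: df|exact: dg].
apply: (@Ck_eq _ _ _ _ ((fun x => f x * 'D_v g x : R^o) \+
                        (fun x => g x * 'D_v f x : R^o))) => //; last first.
  by apply: Ck_add => //; apply: IH; [exact: CkS|exact: cg|exact: CkS|exact: cf].
move=> x Ux; apply/esym/deriveM; apply: diff_derivable; [exact: df|exact: dg].
Qed.

Lemma Ck_comp_linear V W W' n (U : set V) (f : V -> W) (g : {linear W -> W'}) :
  open U -> continuous g -> Ck n U f -> Ck n U (g \o f).
Proof.
move=> oU cg; elim: n f => [|n IH] f.
  by move=> cf x Ux; apply: continuous_comp; [exact: cf|exact: cg].
move=> [df cf]; have dg y : differentiable g y by exact: linear_differentiable.
split=> [x Ux|v]; first by apply: differentiable_comp => //; exact: df.
apply: (@Ck_eq _ _ _ _ (g \o 'D_v f)) => //; last by apply: IH; exact: cf.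
move=> x Ux; have dfx := df x Ux; have dgf := differentiable_comp dfx (dg (f x)).
by rewrite [RHS]deriveE// diff_comp//= diff_lin// deriveE.
Qed.

Lemma Ck_precomp_linear V W W' n (U : set V) (f : V -> W) (g : {linear W' -> V}) :
  open U -> continuous g -> Ck n U f -> Ck n (g @^-1` U) (f \o g).
Proof.
move=> oU cg; elim: n f => [|n IH] f.
  by move=> cf x Ux; apply: continuous_comp; [exact: cg|exact: cf].
move=> [df cf]; have dg y : differentiable g y by exact: linear_differentiable.
split=> [x Ux|v]; first by apply: differentiable_comp => //; exact: df.
apply: (@Ck_eq _ _ _ _ ('D_(g v) f \o g)) => //; last by apply: IH; exact: cf.
- by apply: open_comp => // x _; exact: cg.
move=> x Ux; have dfx := df _ Ux; have dgf := differentiable_comp (dg x) dfx.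
by rewrite [RHS]deriveE// diff_comp//= diff_lin// deriveE.
Qed.

Lemma differentiable_powR (r x : R) : 0 < x ->
  differentiable (fun y => y `^ r : R^o) x.
Proof.
move=> x0; apply/derivable1_diffP.
exact: (ex_derive (is_derive := is_derive1_powR r x0)).
Qed.

Lemma is_diff_powR V (f : V -> R^o) (x : V) r : differentiable f x -> 0 < f x ->
  is_diff x (fun y => f y `^ r : R^o)
    (fun v => r * f x `^ (r - 1) * 'd f x v : R^o).
Proof.
move=> df fx; have dp := differentiable_powR r fx.
split; first exact: (differentiable_comp df dp).
have -> : 'd (fun y => f y `^ r : R^o) x =
    'd (fun y => y `^ r : R^o) (f x) \o 'd f x :> (V -> R^o).
  exact: (diff_comp df dp).
apply/funext => v /=; rewrite deriv1E; last exact/derivable1_diffP.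
have := is_derive1_powR r fx => -[_ e].
by rewrite derive1E e; exact: mulrC.
Qed.

Lemma derive_powR V (f : V -> R^o) (x v : V) r : differentiable f x -> 0 < f x ->
  'D_v (fun y => f y `^ r : R^o) x = r * f x `^ (r - 1) * 'D_v f x.
Proof.
move=> df fx; have [dp e] := is_diff_powR r df fx.
by rewrite !deriveE// e.
Qed.

Lemma Ck_powR V n (U : set V) (f : V -> R^o) r : open U ->
  (forall x, U x -> 0 < f x) -> Ck n U f -> Ck n U (fun x => f x `^ r : R^o).
Proof.
(* The exponent is generalized because differentiation lowers it by 1. *)
move=> oU f0; elim: n r => [|n IH] r Cf.
  move=> x Ux; apply: (@continuous_comp _ _ _ f (fun y => y `^ r : R^o)).
    exact: Cf.
  exact/differentiable_continuous/differentiable_powR/f0.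
have [df cf] := Cf; split=> [x Ux|v].
  by have [] := is_diff_powR r (df x Ux) (f0 x Ux).
apply: (@Ck_eq _ _ _ _ (fun x => (cst r x * f x `^ (r - 1)) * 'D_v f x : R^o)) => //.
  by move=> x Ux; rewrite derive_powR//; [exact: df|exact: f0].
apply: (Ck_mul oU _ (cf v)).
by apply: (Ck_mul oU (Ck_cst n U (r : R^o))); apply: IH; exact: CkS.
Qed.

Lemma Ck_sum V W n (U : set V) (I : Type) (r : seq I) (f : I -> V -> W) : open U ->
  (forall i, Ck n U (f i)) -> Ck n U (fun x => \sum_(i <- r) f i x).
Proof.
move=> oU Cf; elim: r => [|i r IH].
  by apply: (Ck_eq oU _ (Ck_cst n U 0)) => x _; rewrite big_nil.
by apply: (Ck_eq oU _ (Ck_add oU (Cf i) IH)) => x _; rewrite big_cons.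
Qed.

Lemma coord_smooth m n (U : set 'M[R]_(m, n)) i j :
  smooth_on U (fun M : 'M[R]_(m, n) => M i j : R^o).
Proof.
have @f : {linear 'M[R]_(m, n) -> R^o}.
  by exists (fun N : 'M[R]_(_, _) => N i j); do 2![eexists]; do ?[constructor];
     rewrite ?mxE// => ? *; rewrite ?mxE//; move=> ?; rewrite !mxE.
rewrite (_ : (fun _ => _) = f) //; apply: smooth_on_linear.
exact: (@coord_continuous _ m n i j).
Qed.

End DifferentiabilityClasses.

(** * The Hessian of L in a fibre *)

Section Hessian.
Context {R : realType} {n : nat}.
Implicit Types (q : 'M[R]_n) (c : 'cV[R]_n) (u v w : 'rV[R]_n).

Lemma lin_linear c : linear (lin c : 'rV[R]_n -> R^o).
Proof. by move=> t u v; rewrite linD linZ. Qed.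

HB.instance Definition _ c :=
  GRing.isLinear.Build R 'rV[R]_n R^o *:%R (lin c) (lin_linear c).

Lemma linE c v : lin c v = \sum_i v 0 i * c i 0.
Proof. by rewrite /lin mxE. Qed.

Lemma lin_smooth c (U : set 'rV[R]_n) : open U -> smooth_on U (lin c : _ -> R^o).
Proof.
move=> oU N; apply: (Ck_eq oU (f := fun v => \sum_i v 0 i * c i 0)) => [v _|].
  by rewrite linE.
apply: Ck_sum => // i; apply: (Ck_mul oU (coord_smooth U 0 i N)); exact: Ck_cst.
Qed.

Lemma lin_continuous c : continuous (lin c : _ -> R^o).
Proof. by move=> v; exact: (@lin_smooth c setT openT 0%N v I). Qed.

Lemma is_derive_lin c v u : is_derive v u (lin c : _ -> R^o) (lin c u).
Proof.
have dc : differentiable (lin c : _ -> R^o) v.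
  exact/linear_differentiable/lin_continuous.
apply: DeriveDef; first exact: diff_derivable.
by rewrite deriveE// diff_lin//; exact: lin_continuous.
Qed.

Lemma quadE q v :
  bil q v v = \sum_j lin (col j q) v * lin (delta_mx j 0) v.
Proof.
rewrite /bil mxE; apply: eq_bigr => j _; congr (_ * _).
  by rewrite /lin colE mulmxA -colE [in RHS]mxE.
by rewrite /lin -colE !mxE.
Qed.

Lemma quad_smooth q (U : set 'rV[R]_n) : open U ->
  smooth_on U (fun v => bil q v v : R^o).
Proof.
move=> oU N; apply: (Ck_eq oU (f := fun v =>
    \sum_j lin (col j q) v * lin (delta_mx j 0) v)) => [v _|].
  by rewrite quadE.
by apply: Ck_sum => // i; apply: Ck_mul => //; exact: lin_smooth.
Qed.

Lemma is_derive_bill q w v u :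
  is_derive v u (fun v => bil q v w : R^o) (bil q u w).
Proof.
have e v' : bil q v' w = lin (q *m w^T) v' by rewrite /bil /lin mulmxA.
rewrite e (_ : (fun _ => _) = lin (q *m w^T) :> (_ -> R^o)).
  exact: is_derive_lin.
by apply/funext => y; rewrite e.
Qed.

Lemma is_derive_quad q v u : q^T = q ->
  is_derive v u (fun v => bil q v v : R^o) (2 * bil q v u).
Proof.
move=> qT; apply: DeriveDef.
  by have [dq _] := quad_smooth q openT 1%N; apply: diff_derivable; exact: dq.
rewrite /derive; apply: cvg_lim => //.
have -> : (fun h => h^-1 *: (bil q (h *: u + v) (h *: u + v) - bil q v v : R^o)) =
   (fun h => h^-1 * (h * (2 * bil q v u + h * bil q u u))).
  apply/funext => h; congr (_ * _); rewrite !bilE (bilC u v qT); ring.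
apply: (@cvg_trans _ ((fun h => 2 * bil q v u + h * bil q u u) @ (0:R)^')).
  apply: near_eq_cvg; near=> h; rewrite mulKf//.
  by near: h; exact: nbhs_dnbhs_neq.
suff : (fun h => 2 * bil q v u + h * bil q u u) @ (0 : R)^' -->
    2 * bil q v u + 0 * bil q u u by rewrite mul0r addr0.
apply: cvgD; first exact: cvg_cst.
apply: cvgM; [exact: cvg_within|exact: cvg_cst].
Unshelve. all: by end_near. Qed.

Section KundtHessian.
Variables (q : 'M[R]_n) (c : 'cV[R]_n) (p k m : R).
Hypothesis qT : q^T = q.

Definition cone_form v : R := k * bil q v v + m * lin c v ^+ 2.

Definition kundt_form v : R :=
  (lin c v ^+ 2) `^ (- p) * cone_form v `^ (p + 1).

Definition kundt_region : set 'rV[R]_n :=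
  [set v | lin c v != 0 /\ 0 < cone_form v].

Lemma linsq_smooth (U : set 'rV[R]_n) :
  open U -> smooth_on U (fun v => lin c v ^+ 2 : R^o).
Proof. by move=> oU N; apply: Ck_mul => //; exact: lin_smooth. Qed.

Lemma cone_form_smooth (U : set 'rV[R]_n) :
  open U -> smooth_on U (cone_form : _ -> R^o).
Proof.
move=> oU N; apply: Ck_add => //.
  by apply: (Ck_mul oU (Ck_cst N U (k : R^o))); exact: quad_smooth.
by apply: (Ck_mul oU (Ck_cst N U (m : R^o))); exact: linsq_smooth.
Qed.

Lemma cone_form_continuous : continuous (cone_form : _ -> R^o).
Proof. by move=> v; exact: (@cone_form_smooth setT openT 0%N v I). Qed.

Lemma kundt_region_open : open kundt_region.
Proof.
apply: openI.
  by apply: (@open_comp _ _ (lin c : _ -> R^o) [set x | x != 0]) => [x _|];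
    [exact: lin_continuous|exact: open_neq].
by apply: (@open_comp _ _ (cone_form : _ -> R^o) [set x | 0 < x]) => [x _|];
    [exact: cone_form_continuous|exact: open_gt].
Qed.

Lemma is_derive_powR (f : 'rV[R]_n -> R^o) (v u : 'rV[R]_n) (df r : R) :
  differentiable f v -> 0 < f v -> is_derive v u f df ->
  is_derive v u (fun y => f y `^ r : R^o) (r * f v `^ (r - 1) * df).
Proof.
move=> dif f0 [_ <-]; have [d _] := is_diff_powR r dif f0.
by apply: DeriveDef; [exact: diff_derivable|exact: derive_powR].
Qed.

Lemma is_derive_cone v u : is_derive v u (cone_form : _ -> R^o)
  (2 * (k * bil q v u + m * lin c v * lin c u)).
Proof.
have dq := is_derive_quad v u qT; have dl := is_derive_lin c v u.
have -> : cone_form = (k *: (fun v => bil q v v : R^o)) \+ (m *: (lin c : _ -> R^o) ^+ 2).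
  by [].
apply: is_derive_eq; rewrite /= expr1 /GRing.scale /=; ring.
Qed.

(** The derivative l_u of log L along u. The second derivative of L is then L (l_u l_w + D_w l_u),
    so the second differentiation meets only a rational expression and no real power. *)
Definition log_derivative u v : R :=
  2 * ((p + 1) * (k * bil q v u + m * lin c v * lin c u) / cone_form v -
       p * lin c u / lin c v).

Lemma is_derive_kundt v u : kundt_region v ->
  is_derive v u (kundt_form : _ -> R^o) (kundt_form v * log_derivative u v).
Proof.
move=> [c0 C0]; have dl := is_derive_lin c v u; have dC := is_derive_cone v u.
have s0 : 0 < lin c v ^+ 2 by rewrite exprn_even_gt0.
have dsq : is_derive v u (fun v => lin c v ^+ 2 : R^o) (2 * lin c v * lin c u).
  rewrite (_ : (fun _ => _) = (lin c : _ -> R^o) ^+ 2)//.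
  by apply: is_derive_eq; rewrite /= expr1.
have [dif1 _] := linsq_smooth openT 1%N; have [dif2 _] := cone_form_smooth openT 1%N.
have d1 := is_derive_powR (- p) (dif1 v I) s0 dsq.
have d2 := is_derive_powR (p + 1) (dif2 v I) C0 dC.
have -> : kundt_form = (fun v => (lin c v ^+ 2) `^ (- p) : R^o) *
                       (fun v => cone_form v `^ (p + 1) : R^o) by [].
apply: is_derive_eq; rewrite /log_derivative !fctE /GRing.scale /=.
rewrite !powRB ?(gt_eqF s0) ?(gt_eqF C0) ?implybT// !powRr1 ?ltW//.
by field; rewrite c0 gt_eqF.
Qed.

Lemma is_derive_log_derivative v u w : kundt_region v ->
  is_derive v w (log_derivative u : _ -> R^o)
   (2 * ((p + 1) * ((k * bil q w u + m * lin c w * lin c u) / cone_form v -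
       2 * (k * bil q v u + m * lin c v * lin c u) *
           (k * bil q v w + m * lin c v * lin c w) / cone_form v ^+ 2) +
     p * lin c u * lin c w / lin c v ^+ 2)).
Proof.
move=> [c0 C0]; have dl := is_derive_lin c v w; have dC := is_derive_cone v w.
have db := is_derive_bill q u v w.
have C0' : cone_form v != 0 by rewrite gt_eqF.
have dCV : is_derive v w (fun v => (cone_form v)^-1 : R^o) (- (cone_form v) ^- 2 *:
    (2 * (k * bil q v w + m * lin c v * lin c w))).
  by case: dC => d <-; apply: DeriveDef; [exact: derivableV|exact: deriveV].
have dlV : is_derive v w (fun v => (lin c v)^-1 : R^o) (- (lin c v) ^- 2 *: lin c w).
  by case: dl => d <-; apply: DeriveDef; [exact: derivableV|exact: deriveV].
have -> : log_derivative u = 2 *: ((p + 1) *: ((k *: (fun v => bil q v u : R^o) +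
    (m * lin c u) *: (lin c : _ -> R^o)) * (fun v => (cone_form v)^-1 : R^o)) -
    (p * lin c u) *: (fun v => (lin c v)^-1 : R^o)).
  apply/funext => y; rewrite /log_derivative !fctE /GRing.scale /=; ring.
have d1 := is_deriveM (is_deriveD (is_deriveZ k db) (is_deriveZ (m * lin c u) dl)) dCV.
have d2 := is_deriveB (is_deriveZ (p + 1) d1) (is_deriveZ (p * lin c u) dlV).
apply: (is_derive_eq (is_deriveZ 2 d2)); rewrite !fctE /GRing.scale /= /GRing.scale /=.
by field; rewrite c0 C0'.
Qed.

(** The covector e of the fundamental tensor, evaluated at u. The derivative of A / B^2 along u is 2
    / B^2 times this number; as A / B^2 is homogeneous of degree 0, it vanishes for u = v. *)
Definition hessian_factor v u : R :=
  bil q v u - bil q v v / lin c v * lin c u.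

Lemma hessian_kundt v u w : kundt_region v ->
  2^-1 * 'D_w (fun y => 'D_u (kundt_form : _ -> R^o) y : R^o) v =
  kundt_form v / cone_form v *
   ((p + 1) * k * bil q u w +
    (m * lin c v ^+ 2 - p * k * bil q v v) / lin c v ^+ 2 * (lin c u * lin c w) +
    2 * p * (p + 1) * k ^+ 2 / cone_form v *
       (hessian_factor v u * hessian_factor v w)).
Proof.
move=> rv; rewrite (near_eq_derive (g := kundt_form * log_derivative u)); last first.
  apply: near_open kundt_region_open rv _ => y ry.
  by have [_ ->] := is_derive_kundt u ry.
have d1 := is_derive_kundt w rv; have d2 := is_derive_log_derivative u w rv.
have [_ ->] := is_deriveM d1 d2.
case: rv => c0 C0; have C0' : cone_form v != 0 by rewrite gt_eqF.
rewrite /GRing.scale /= /log_derivative /hessian_factor (bilC w u qT).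
move: C0'; rewrite /cone_form => C0'.
by field; rewrite c0 C0'.
Qed.

End KundtHessian.

End Hessian.

(** * Signature of the fundamental tensor *)

Section KundtMetric.
Context {R : realType} {n : nat}.
Variables (q : 'M[R]_n) (c : 'cV[R]_n) (p k m : R).
Hypothesis lq : lorentzian q.
Implicit Types u v w : 'rV[R]_n.

Let qT := lorentzian_sym lq.

Definition sharp : 'rV[R]_n := (invmx q *m c)^T.

(** At a point x this is convertible to [form_norm a b x], so that hypotheses on the latter apply as
    they are. *)
Definition conorm : R := (c^T *m invmx q *m c) 0 0.

Lemma bil_sharp u : bil q u sharp = lin c u.
Proof. by rewrite /bil /lin trmxK -mulmxA mulKVmx// lorentzian_unit. Qed.

Lemma lin_sharp : lin c sharp = conorm.
Proof. by rewrite /lin /sharp trmx_mul trmx_inv qT. Qed.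

Lemma sharp_eq0 : (sharp == 0) = (c == 0).
Proof.
apply/eqP/eqP => [s0|c0]; last by rewrite /sharp c0 mulmx0 trmx0.
apply/colP => i; rewrite mxE -lin_delta -bil_sharp s0.
by rewrite bil0r.
Qed.

Lemma lin_gt_conorm v : 0 < bil q v v -> conorm * bil q v v <= lin c v ^+ 2.
Proof.
move=> v0; have := reverse_cauchy_schwarz sharp lq v0.
by rewrite !bil_sharp lin_sharp mulrC.
Qed.

(** If B vanished at a timelike v, the dual of c would be orthogonal to v, hence spacelike. *)
Lemma lin_neq0 v : c != 0 -> 0 <= conorm -> 0 < bil q v v -> lin c v != 0.
Proof.
move=> c0 n0 v0; apply: contraTN n0 => /eqP cv; rewrite -ltNge -lin_sharp.
rewrite -bil_sharp; apply: (lorentzian_orth_lt0 lq v0); rewrite ?sharp_eq0//.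
by rewrite bil_sharp.
Qed.

Lemma ker_le0 u : c != 0 -> 0 <= conorm -> lin c u = 0 -> bil q u u <= 0.
Proof.
move=> c0 n0 cu; rewrite leNgt; apply/negP => u0.
by have := lin_neq0 c0 n0 u0; rewrite cu eqxx.
Qed.

(** Cauchy-Schwarz on the orthogonal of v, between u and the projection of the dual of c, whose
    square is n - B^2 / A. *)
Lemma orth_lin_le u v : 0 < bil q v v -> bil q v u = 0 ->
  lin c u ^+ 2 * bil q v v <= - bil q u u * (lin c v ^+ 2 - conorm * bil q v v).
Proof.
move=> v0 vu; have v0' : bil q v v != 0 by rewrite gt_eqF.
have := orth_cauchy_schwarz lq v0 vu (orth_split sharp v0').
rewrite !bilE !bil_sharp lin_sharp (bilC u v qT) vu (bilC _ v qT) bil_sharp.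
rewrite mulr0 subr0 -(ler_pM2r v0) => /le_trans; apply.
by rewrite le_eqVlt; apply/orP; left; apply/eqP; field.
Qed.

Definition kundt_metric v : 'M[R]_n :=
  (kundt_form q c p k m v / cone_form q c k m v) *: (((p + 1) * k) *: q +
    ((m * lin c v ^+ 2 - p * k * bil q v v) / lin c v ^+ 2) *: (c *m c^T) +
    (2 * p * (p + 1) * k ^+ 2 / cone_form q c k m v) *:
      (let e := q *m v^T - (bil q v v / lin c v) *: c in e *m e^T)).

Lemma kundt_metricE v u w : bil (kundt_metric v) u w =
  kundt_form q c p k m v / cone_form q c k m v *
   ((p + 1) * k * bil q u w +
    (m * lin c v ^+ 2 - p * k * bil q v v) / lin c v ^+ 2 * (lin c u * lin c w) +
    2 * p * (p + 1) * k ^+ 2 / cone_form q c k m v *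
       (hessian_factor q c v u * hessian_factor q c v w)).
Proof.
rewrite /kundt_metric !(bil_scaleq, bil_addq) !bil_square.
have e z : lin (q *m v^T - (bil q v v / lin c v) *: c) z = hessian_factor q c v z.
  rewrite /lin mulmxBr mulmxA -scalemxAr !mxE /hessian_factor (bilC v z qT).
  by rewrite /bil /lin !mxE.
by rewrite !e.
Qed.

Lemma kundt_metric_sym v : (kundt_metric v)^T = kundt_metric v.
Proof.
rewrite /kundt_metric; move: (q *m _ - _) => e.
rewrite linearZ /= !linearD /= !linearZ /= qT.
by rewrite ![(_ *m _^T)^T]trmx_mul !trmxK.
Qed.

(* For v of the domain, it has the sign of the determinant of [kundt_metric v]
   relative to that of q, when k and p + 1 are positive. *)
Definition kundt_discriminant v : R :=
  k * (1 - p) * (lin c v ^+ 2 - conorm * bil q v v) + conorm * cone_form q c k m v.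

Section Point.
Variable v : 'rV[R]_n.
Hypotheses (A0 : 0 < bil q v v) (B0 : lin c v != 0) (C0 : 0 < cone_form q c k m v).

Let sq0 : 0 < lin c v ^+ 2. Proof. by rewrite exprn_even_gt0. Qed.

Lemma kundt_form_gt0 : 0 < kundt_form q c p k m v.
Proof. by rewrite mulr_gt0// powR_gt0. Qed.

Let f0 : 0 < kundt_form q c p k m v / cone_form q c k m v.
Proof. by rewrite divr_gt0// kundt_form_gt0. Qed.

(** Euler's relation for a function homogeneous of degree 2, read off the formula since
    [hessian_factor] vanishes at v. *)
Lemma kundt_metric_self : bil (kundt_metric v) v v = kundt_form q c p k m v.
Proof.
have C0' : cone_form q c k m v != 0 by rewrite gt_eqF.
rewrite kundt_metricE.
have -> : hessian_factor q c v v = 0 by rewrite /hessian_factor divfK// subrr.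
rewrite mul0r mulr0 addr0.
move: C0'; set F := kundt_form _ _ _ _ _ _; rewrite /cone_form => C0'.
by field; rewrite B0.
Qed.

Lemma kundt_metric_gram u : bil q v u = 0 ->
  bil (kundt_metric v) v v * bil (kundt_metric v) u u -
    bil (kundt_metric v) v u ^+ 2 =
  (kundt_form q c p k m v / cone_form q c k m v) ^+ 2 * ((p + 1) * k) *
  (cone_form q c k m v * bil q u u + lin c u ^+ 2 * bil q v v *
     (m * lin c v ^+ 2 + p * k * bil q v v) / lin c v ^+ 2).
Proof.
move=> vu; have C0' : cone_form q c k m v != 0 by rewrite gt_eqF.
rewrite kundt_metric_self !kundt_metricE /hessian_factor vu.
set F := kundt_form _ _ _ _ _ _; move: C0'; rewrite /cone_form => C0'.
by field; rewrite B0.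
Qed.

Hypotheses (k0 : 0 < k) (p0 : -1 < p).

Let p1k : 0 < (p + 1) * k. Proof. by rewrite mulr_gt0// -ltrBlDr sub0r. Qed.

Lemma kundt_gram_lt0 u : 0 < kundt_discriminant v -> u != 0 -> bil q v u = 0 ->
  bil (kundt_metric v) v v * bil (kundt_metric v) u u <
    bil (kundt_metric v) v u ^+ 2.
Proof.
move=> N0 u0 vu; rewrite -subr_lt0 (kundt_metric_gram vu).
rewrite pmulr_rlt0; last by rewrite mulr_gt0// exprn_gt0.
have U0 := lorentzian_orth_lt0 lq A0 vu u0.
(* The coefficient of [lin c u ^+ 2] has the sign of m B^2 + p k A. If it is nonpositive, the
   negative term in [bil q u u] decides; otherwise [orth_lin_le] bounds [lin c u ^+ 2], and the sum
   factors through the discriminant. *)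
have [M0|M0] := lerP (m * lin c v ^+ 2 + p * k * bil q v v) 0.
  have CU : cone_form q c k m v * bil q u u < 0 by rewrite pmulr_rlt0.
  apply: le_lt_trans CU; rewrite gerDl pmulr_lle0 ?invr_gt0//.
  by rewrite mulr_ge0_le0// mulr_ge0 ?sqr_ge0// ltW.
have h := orth_lin_le A0 vu.
have : lin c u ^+ 2 * bil q v v *
     (m * lin c v ^+ 2 + p * k * bil q v v) / lin c v ^+ 2 <=
  - bil q u u * (lin c v ^+ 2 - conorm * bil q v v) *
     (m * lin c v ^+ 2 + p * k * bil q v v) / lin c v ^+ 2.
  by rewrite ler_pM2r ?invr_gt0// ler_pM2r.
rewrite -(lerD2l (cone_form q c k m v * bil q u u)) => /le_lt_trans; apply.
have -> : cone_form q c k m v * bil q u u +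
    - bil q u u * (lin c v ^+ 2 - conorm * bil q v v) *
     (m * lin c v ^+ 2 + p * k * bil q v v) / lin c v ^+ 2 =
   bil q u u * (bil q v v * kundt_discriminant v / lin c v ^+ 2).
  by rewrite /kundt_discriminant /cone_form; field.
by rewrite nmulr_rlt0// divr_gt0// mulr_gt0.
Qed.

Lemma kundt_metric_lorentzian :
  0 < kundt_discriminant v -> lorentzian (kundt_metric v).
Proof.
move=> N0; have GT := kundt_metric_sym v; have G0 : 0 < bil (kundt_metric v) v v.
  by rewrite kundt_metric_self kundt_form_gt0.
apply: (lorentzian_criterion GT G0) => u u0 vu.
(* Here u is orthogonal to v for [kundt_metric v], while the Gram inequality is for q-orthogonal
   vectors. Passing from u to u' adds a multiple of v, which preserves the Gram determinant. *)
pose t := bil q v u / bil q v v; pose u' := u - t *: v.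
have vu' : bil q v u' = 0 by apply: orth_split; rewrite gt_eqF.
have uE : u = u' + t *: v by rewrite subrK.
have u'0 : u' != 0.
  apply: contra u0 => /eqP u'0; move: vu; rewrite uE u'0 add0r bilZr => /eqP.
  by rewrite mulf_eq0 (gt_eqF G0) orbF => /eqP ->; rewrite scale0r.
have := kundt_gram_lt0 N0 u'0 vu'.
have -> : bil (kundt_metric v) v u' = - t * bil (kundt_metric v) v v.
  by rewrite /u' !bilE vu; ring.
have -> : bil (kundt_metric v) u' u' =
    bil (kundt_metric v) u u + t ^+ 2 * bil (kundt_metric v) v v.
  by rewrite /u' !bilE (bilC u v GT) vu; ring.
by rewrite -(pmulr_rlt0 _ G0); nra.
Qed.

(** The test vector u is the equality case of [orth_lin_le]. Its square is n - B^2 / A, so the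
    second hypothesis makes it spacelike and allows division by that square. *)
Lemma kundt_discriminant_ge0 : lorentzian (kundt_metric v) ->
  conorm * bil q v v < lin c v ^+ 2 -> 0 <= kundt_discriminant v.
Proof.
move=> lG nB; pose u := sharp - (bil q v sharp / bil q v v) *: v.
have A0' : bil q v v != 0 by rewrite gt_eqF.
have vu : bil q v u = 0 by exact: orth_split.
have := reverse_cauchy_schwarz (v := v) u lG.
rewrite {1}kundt_metric_self => /(_ kundt_form_gt0).
rewrite -subr_le0 (kundt_metric_gram vu).
rewrite pmulr_rle0; last by rewrite mulr_gt0// exprn_gt0.
have uu : bil q u u = conorm - lin c v ^+ 2 / bil q v v.
  rewrite /u !bilE !bil_sharp lin_sharp (bilC sharp v qT) bil_sharp; field.
  by [].
have cu : lin c u = bil q u u.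
  by rewrite uu /u !bilE bil_sharp lin_sharp; field.
rewrite cu {}uu; set U := conorm - _.
have U0 : U < 0 by rewrite subr_lt0 ltr_pdivlMr.
have -> : cone_form q c k m v * U + U ^+ 2 * bil q v v *
    (m * lin c v ^+ 2 + p * k * bil q v v) / lin c v ^+ 2 =
    U * (bil q v v * kundt_discriminant v / lin c v ^+ 2).
  by rewrite /U /kundt_discriminant /cone_form; field; rewrite A0' B0.
by rewrite nmulr_rle0// pmulr_lge0 ?invr_gt0// pmulr_rge0.
Qed.

End Point.

(* The dual of c minus (2 k B / C) v is in the kernel. *)
Lemma kundt_metric_degenerate v : 0 < bil q v v -> lin c v != 0 ->
  0 < cone_form q c k m v -> k != 0 -> p = 1 -> conorm = 0 ->
  kundt_metric v \notin unitmx.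
Proof.
move=> A0 B0 C0 k0 p1 n0; pose t := 2 * k / cone_form q c k m v * lin c v.
have C0' : cone_form q c k m v != 0 by rewrite gt_eqF.
pose u := sharp - t *: v.
have u0 : u != 0.
  apply/eqP => /eqP; rewrite subr_eq0 => /eqP sv.
  have : bil q sharp sharp != 0.
    have t0 : t != 0 by rewrite /t !mulf_neq0 ?invr_eq0// pnatr_eq0.
    by rewrite sv !bilE; apply/mulf_neq0/mulf_neq0 => //; rewrite gt_eqF.
  by rewrite bil_sharp lin_sharp n0 eqxx.
have Gu w : bil (kundt_metric v) w u = 0.
  rewrite kundt_metricE /hessian_factor /u !bilE !bil_sharp lin_sharp n0 p1.
  rewrite (bilC v w qT) /t; move: C0'; set F := kundt_form _ _ _ _ _ _.
  rewrite /cone_form => C0'; field.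
  by apply/andP; split; [exact: C0'|exact: B0].
apply/negP => uG; move/negP: u0; apply.
suff : u *m kundt_metric v == 0.
  move=> /eqP/(congr1 (mulmx^~ (invmx (kundt_metric v)))).
  by rewrite mulmxK// mul0mx => ->.
apply/eqP/rowP => i; rewrite -bil_delta bilC ?kundt_metric_sym//.
by rewrite Gu mxE.
Qed.

Lemma kundt_discriminant_gt0_pos v : 0 < bil q v v -> lin c v != 0 ->
  0 < cone_form q c k m v -> 0 < k -> 0 <= conorm -> p <= 1 ->
  (p = 1 -> conorm != 0) -> 0 < kundt_discriminant v.
Proof.
move=> A0 B0 C0 k0 n0 p1 np; have := lin_gt_conorm A0.
rewrite -subr_ge0 => BA; rewrite /kundt_discriminant.
have [n_eq0|n_neq0] := eqVneq conorm 0.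
  rewrite n_eq0 !mul0r subr0 addr0 mulr_gt0 ?exprn_even_gt0// mulr_gt0//.
  rewrite subr_gt0 lt_neqAle p1 andbT; apply/eqP => /np.
  by rewrite n_eq0 eqxx.
apply: ltr_wpDl; first by rewrite mulr_ge0// mulr_ge0 ?subr_ge0// ltW.
by rewrite mulr_gt0// lt_def n_neq0.
Qed.

Lemma kundt_discriminant_gt0_neg v : 0 < bil q v v -> lin c v != 0 ->
  0 < k -> m < 0 -> conorm < 0 -> p < 0 -> 0 < kundt_discriminant v.
Proof.
move=> A0 B0 k0 m0 n0 p0.
(* Regrouped in this way, both summands are positive once m, n and p are negative. *)
have -> : kundt_discriminant v = k * (1 - p) * lin c v ^+ 2 +
  conorm * (m * lin c v ^+ 2 + p * k * bil q v v).
  by rewrite /kundt_discriminant /cone_form; ring.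
have B2 : 0 < lin c v ^+ 2 by rewrite exprn_even_gt0.
have mB : m * lin c v ^+ 2 < 0 by rewrite nmulr_rlt0.
have pA : p * k * bil q v v < 0 by rewrite -mulrA nmulr_rlt0// mulr_gt0.
have h1 : 0 < k * (1 - p) * lin c v ^+ 2 by rewrite mulr_gt0// mulr_gt0//; lra.
apply: addr_gt0 => //; rewrite nmulr_rgt0//; lra.
Qed.

(** Two linear equations have a nonzero common solution as soon as the dimension is at least 3. *)
Lemma exists_orth_ker v : (2 < n)%N ->
  exists u, [/\ u != 0, bil q v u = 0 & lin c u = 0].
Proof.
move=> n2; pose K := row_mx (q *m v^T) c.
have : kermx K != 0.
  rewrite -mxrank_eq0 mxrank_ker subn_eq0 -ltnNge.
  exact: leq_ltn_trans (rank_leq_col _) n2.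
case/rowV0Pn => u /sub_kermxP; rewrite mul_mx_row -row_mx0 => /eq_row_mx[h1 h2] u0.
exists u; split => //; last by rewrite /lin h2 mxE.
by rewrite bilC// /bil -mulmxA h1 mxE.
Qed.

End KundtMetric.

Section Fundamental.
Context {R : realType} {d : nat} (M : manifold R d).
Variables (a : M -> 'M[R]_d) (b : M -> 'cV[R]_d) (p k m : R).
Hypothesis la : forall x, lorentzian (a x).

Lemma kundt_domE x (v : 'rV[R]_d) : kundt_dom a b k m (tvec x v) <->
  [/\ 0 < bil (a x) v v, lin (b x) v != 0 & 0 < cone_form (a x) (b x) k m v].
Proof.
rewrite /kundt_dom /cone_form /= -[Aform a _]/(bil (a x) v v).
rewrite -[Bform b _]/(lin (b x) v).
have e : 0 < bil (a x) v v -> k * bil (a x) v v + m * lin (b x) v ^+ 2 =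
    bil (a x) v v * (k + m * (lin (b x) v ^+ 2 / bil (a x) v v)).
  by move=> A0; field; rewrite gt_eqF.
by split=> -[A0 B0 C0]; split=> //; move: C0; rewrite (e A0) pmulr_rgt0.
Qed.

Lemma kundt_kundt_form x (v : 'rV[R]_d) : kundt_dom a b k m (tvec x v) ->
  kundt a b p k m (tvec x v) = kundt_form (a x) (b x) p k m v.
Proof. by move=> /kundtE ->. Qed.

Lemma quad_continuous (q : 'M[R]_d) : continuous (fun v => bil q v v : R^o).
Proof. by move=> v; exact: (@quad_smooth _ _ q setT openT 0%N v I). Qed.

Lemma fiber_kundt_dom_open x : open (fiber (kundt_dom a b k m) x).
Proof.
rewrite (_ : fiber _ _ = [set v | 0 < bil (a x) v v] `&`
    kundt_region (a x) (b x) k m).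
  apply: openI; last exact: kundt_region_open.
  by apply: (@open_comp _ _ (fun v => bil (a x) v v : R^o) [set y | 0 < y]) => [v _|];
    [exact: quad_continuous|exact: open_gt].
apply/seteqP; split => [v /kundt_domE[]//|v /= [A0 [B0 C0]]].
exact/kundt_domE.
Qed.

Lemma fundamental_kundt x (v : 'rV[R]_d) : kundt_dom a b k m (tvec x v) ->
  fundamental (kundt a b p k m) (tvec x v) = kundt_metric (a x) (b x) p k m v.
Proof.
move=> dv; have oD := @fiber_kundt_dom_open x.
have aT := lorentzian_sym (la x).
apply/matrixP => i j; rewrite mxE.
pose f := kundt_form (a x) (b x) p k m : 'rV[R]_d -> R^o.
(* [kundt] agrees with [kundt_form] only on the open domain, so each of the two derivatives is
   replaced by a local argument. *)
rewrite (@near_eq_derive _ _ _ _ ('D_(delta_mx 0 j) f)); last first.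
  apply: (near_open oD dv) => u du; apply: near_eq_derive.
  by apply: (near_open oD du) => w dw; exact: kundt_kundt_form.
case/kundt_domE: (dv) => A0 B0 C0.
rewrite -[LHS]/(2^-1 * _) hessian_kundt// -kundt_metricE// bil_delta -rowE mxE.
(* The Hessian formula has produced the (j, i) entry; symmetry exchanges the indices. *)
by rewrite -[in LHS](kundt_metric_sym _ _ _ _ (la x)) mxE.
Qed.

End Fundamental.

(** * Connectedness and time cones *)

Section Connectedness.

Lemma component_clopen (T : topologicalType) (S K : set T) v :
  connected K -> K v -> (exists2 U, open U & K = S `&` U) ->
  (exists2 C, closed C & K = S `&` C) -> connected_component S v = K.
Proof.
move=> cK Kv [U oU KU] [C cC KC]; have KS : K `<=` S by rewrite KU => x [].
have Sv := KS _ Kv; have KZ := connected_component_max Kv KS cK.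
apply/seteqP; split; last exact: KZ.
have cSS := @connected_component_sub _ S v.
suff e : connected_component S v `&` K = connected_component S v.
  by rewrite -e => x [].
apply: (@component_connected _ S v); first by exists v; split => //; exact: KZ.
- exists U => //; apply/seteqP; split => x [Sx]; rewrite ?KU => h; split=> //.
    by case: h.
  by split => //; exact: cSS.
- exists C => //; apply/seteqP; split => x [Sx]; rewrite ?KC => h; split=> //.
    by case: h.
  by split => //; exact: cSS.
Qed.

(** Meant for D the domain of L in a fibre and K the fibre of T, which is open and relatively closed
    in D. *)
Lemma connected_sub_clopen (T : topologicalType) (D K S : set T) :
  open K -> closure K `&` D `<=` K -> connected S -> S `<=` D ->
  S `&` K !=set0 -> S `<=` K.
Proof.
move=> oK cK cS SD SK; suff e : S `&` K = S by rewrite -e => x [].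
apply: cS => //; first by exists K.
exists (closure K); first exact: closed_closure.
apply/seteqP; split => x [Sx Kx]; split=> //; first exact: subset_closure.
by apply: cK; split=> //; exact: SD.
Qed.

Context {R : realType}.

Lemma star_connected (V : normedModType R) (S : set V) (v : V) :
  (forall w (t : R), S w -> 0 <= t <= 1 -> S (v + t *: (w - v))) -> connected S.
Proof.
move=> star; have [->|/set0P[u Su]] := eqVneq S set0; first exact: connected0.
pose seg w := (fun t : R => v + t *: (w - v)) @` `[0, 1].
have segS w : S w -> seg w `<=` S.
  by move=> Sw _ [t /= + <-]; rewrite in_itv /= => /(star _ _ Sw).
have -> : S = \bigcup_(w in S) seg w.
  apply/seteqP; split => [w Sw|w [w' Sw']]; last exact: segS.
  exists w => //; exists 1; first by rewrite /= in_itv /= lexx ler01.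
  by rewrite scale1r addrC subrK.
apply: bigcup_connected.
  exists v => w Sw; exists 0; first by rewrite /= in_itv /= lexx ler01.
  by rewrite scale0r addr0.
move=> w Sw; apply: connected_continuous_connected; first exact: segment_connected.
apply: continuous_subspaceT => t; apply: cvgD; first exact: cvg_cst.
by apply: cvgZl; exact: cvg_id.
Qed.

Lemma convex_cone_connected (V : normedModType R) (S : set V) :
  (forall u v, S u -> S v -> S (u + v)) ->
  (forall (t : R) u, 0 < t -> S u -> S (t *: u)) -> connected S.
Proof.
move=> SD SZ; have [->|/set0P[v Sv]] := eqVneq S set0; first exact: connected0.
apply: (@star_connected _ _ v) => w t Sw /andP[t0 t1].
have -> : v + t *: (w - v) = (1 - t) *: v + t *: w.
  by rewrite scalerBr scalerBl scale1r addrCA addrC -addrA [- _ + _]addrC addrA.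
have [->|tn0] := eqVneq t 0; first by rewrite subr0 scale1r scale0r addr0.
have [->|tn1] := eqVneq t 1; first by rewrite subrr scale1r scale0r add0r.
apply: SD; apply: SZ => //; first by rewrite subr_gt0 lt_neqAle tn1.
by rewrite lt_neqAle eq_sym tn0.
Qed.

Lemma closure_half_segment (V : normedModType R) (S : set V) (v u : V) :
  (forall t : R, 0 <= t < 1 -> S (v + t *: u)) -> closure S (v + u).
Proof.
move=> Sv B nB.
have ct : (fun t : R => v + t *: u) @ (1 : R)^'- --> v + u.
  rewrite -[X in _ --> _ + X]scale1r; apply: cvgD; first exact: cvg_cst.
  by apply: cvgZl; apply: cvg_at_left_filter; exact: cvg_id.
have h := ct B nB.
have : \forall t \near (1 : R)^'-, S (v + t *: u) /\ B (v + t *: u).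
  near=> t; split; last by near: t.
  apply: Sv; apply/andP; split; last by near: t; exact: nbhs_left_lt.
  by apply: ltW; near: t; apply: nbhs_left_gt; exact: ltr01.
by move=> /filter_ex[t]; exists (v + t *: u).
Unshelve. all: by end_near. Qed.

(** The half-open segment is connected, so K contains all of it as long as it stays in D. The end
    point may leave D and is reached only in the closure: this is how boundary vectors of K are
    produced. *)
Lemma half_segment_sub (V : normedModType R) (D K : set V) (v u : V) :
  open K -> closure K `&` D `<=` K -> K v ->
  (forall t : R, 0 <= t < 1 -> D (v + t *: u)) ->
  (forall t : R, 0 <= t < 1 -> K (v + t *: u)) /\ closure K (v + u).
Proof.
move=> oK cK Kv Dv.
pose S := (fun t : R => v + t *: u) @` [set t | 0 <= t < 1].
have Sv : S v by exists 0; rewrite /= ?lexx ?ltr01// scale0r addr0.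
have cS : connected S.
  apply: (@star_connected _ _ v) => _ t [s /andP[s0 s1] <-] /andP[t0 t1].
  exists (t * s); last by rewrite addrAC subrr add0r scalerA.
  by rewrite /= mulr_ge0// (le_lt_trans _ s1)// ler_piMl.
have SK : S `<=` K.
  apply: connected_sub_clopen oK cK cS _ _; last by exists v.
  by move=> _ [t t01 <-]; exact: Dv.
have Kt t : 0 <= t < 1 -> K (v + t *: u) by move=> t01; apply: SK; exists t.
by split=> //; exact: closure_half_segment.
Qed.

End Connectedness.

Section TimeCones.
Context {R : realType} {n : nat}.
Variables (q : 'M[R]_n) (c : 'cV[R]_n) (k m : R).
Hypothesis lq : lorentzian q.
Implicit Types u v w : 'rV[R]_n.

Let qT := lorentzian_sym lq.

(** The combination z of v and w is orthogonal to v0, so its square is nonpositive; in the expansion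
    only the cross term can compensate the two positive squares. *)
Lemma same_cone v0 v w : 0 < bil q v v -> 0 < bil q w w -> 0 < bil q v0 v0 ->
  0 < bil q v0 v -> 0 < bil q v0 w -> 0 < bil q v w.
Proof.
move=> v1 w1 v01 a1 b1; pose z := (bil q v0 w) *: v - (bil q v0 v) *: w.
have z0 : bil q v0 z = 0 by rewrite /z !bilE; ring.
have := lorentzian_orth_le0 lq v01 z0.
rewrite /z !bilE (bilC w v qT) => h.
have p1 : 0 < bil q v0 w * (bil q v0 w * bil q v v) by rewrite !mulr_gt0.
have p2 : 0 < bil q v0 v * (bil q v0 v * bil q w w) by rewrite !mulr_gt0.
have : 0 < bil q v0 w * bil q v0 v * bil q v w by nra.
by rewrite pmulr_rgt0// mulr_gt0.
Qed.

Lemma timelike_bil_neq0 v w : 0 < bil q v v -> 0 < bil q w w -> bil q v w != 0.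
Proof.
move=> v0 w0; apply: contraTneq (w0) => vw; rewrite -leNgt.
exact: lorentzian_orth_le0 vw.
Qed.

Lemma bil_continuous v : continuous (fun w => bil q v w : R^o).
Proof.
rewrite (_ : (fun _ => _) = lin (q^T *m v^T) :> (_ -> R^o)).
  exact: lin_continuous.
apply/funext => w; rewrite bilC// qT /bil /lin -mulmxA.
by [].
Qed.

(** Since [bil q v0] has no zero among timelike vectors, the open and the closed half-space cut out
    the same set, which is therefore clopen; being a convex cone, it is connected. *)
Lemma timelike_component v0 : 0 < bil q v0 v0 ->
  connected_component [set v | 0 < bil q v v] v0 =
  [set v | 0 < bil q v v /\ 0 < bil q v0 v].
Proof.
move=> v00; apply: component_clopen => //.
- apply: convex_cone_connected => [u v /= [u1 u2] [v1 v2]|t u t0 /= [u1 u2]].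
    rewrite !bilE (bilC v u qT).
    have uv := same_cone u1 v1 v00 u2 v2; split; last exact: addr_gt0.
    by rewrite !addr_gt0.
  by rewrite !bilE !mulr_gt0.
- exists [set v | 0 < bil q v0 v]; last by [].
  apply: (@open_comp _ _ (fun w => bil q v0 w : R^o) [set y | 0 < y]) => [v _|].
    exact: bil_continuous.
  exact: open_gt.
- exists [set v | 0 <= bil q v0 v].
    apply: (@closed_comp _ _ (fun w => bil q v0 w : R^o) [set y | 0 <= y]) => [v _|].
      exact: bil_continuous.
    exact: closed_ge.
  apply/seteqP; split => v /= [v1 v2]; split => //; first exact: ltW.
  by rewrite lt_def v2 timelike_bil_neq0.
Qed.

Hypotheses (k0 : 0 < k) (m0 : m < 0).

Lemma cone_form_timelike v : 0 < cone_form q c k m v -> 0 < bil q v v.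
Proof.
rewrite /cone_form => C0; rewrite -(pmulr_rgt0 _ k0).
have : m * lin c v ^+ 2 <= 0 by rewrite nmulr_rle0 ?sqr_ge0.
lra.
Qed.

(** The cross term is 2 (k a(v, w) + m B(v) B(w)). Multiplying the inequalities -m B^2 < k A at v
    and at w, and using the reverse Cauchy-Schwarz inequality, gives |m B(v) B(w)| <= k a(v, w). *)
Lemma cone_formD v w : 0 < cone_form q c k m v -> 0 < cone_form q c k m w ->
  0 < bil q v w -> 0 < cone_form q c k m (v + w).
Proof.
move=> Cv Cw vw; have Av := cone_form_timelike Cv; have Aw := cone_form_timelike Cw.
have RCS := reverse_cauchy_schwarz w lq Av.
suff h : - m * (lin c v * lin c w) <= k * bil q v w.
  by move: Cv Cw; rewrite /cone_form !bilE (bilC w v qT); nra.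
have kvw : 0 <= k * bil q v w by rewrite mulr_ge0// ltW.
rewrite (le_trans (ler_norm _))// -(ger0_norm kvw) -ler_sqr ?nnegrE//.
rewrite -[leLHS]normrX -[leRHS]normrX !ger0_norm ?sqr_ge0//.
have h1 : 0 <= - m * lin c v ^+ 2 by rewrite mulr_ge0 ?sqr_ge0// oppr_ge0 ltW.
have h2 : 0 <= - m * lin c w ^+ 2 by rewrite mulr_ge0 ?sqr_ge0// oppr_ge0 ltW.
have h3 : (- m * lin c v ^+ 2) * (- m * lin c w ^+ 2) <=
      (k * bil q v v) * (k * bil q w w).
  by apply: ler_pM => //; move: Cv Cw; rewrite /cone_form; lra.
apply: le_trans (_ : k ^+ 2 * (bil q v v * bil q w w) <= _).
  apply: le_trans (le_trans h3 _); rewrite le_eqVlt; apply/orP; left; apply/eqP; ring.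
by rewrite exprMn ler_pM2l// exprn_gt0.
Qed.

Lemma cone_formZ t v : cone_form q c k m (t *: v) = t ^+ 2 * cone_form q c k m v.
Proof. by rewrite /cone_form !bilE; ring. Qed.

Definition future_cone v0 : set 'rV[R]_n :=
  [set v | 0 < cone_form q c k m v /\ 0 < bil q v0 v].

Lemma future_coneD v0 u v : 0 < bil q v0 v0 ->
  future_cone v0 u -> future_cone v0 v -> future_cone v0 (u + v).
Proof.
move=> v00 [u1 u2] [v1 v2]; split; last by rewrite bilE addr_gt0.
apply: cone_formD => //.
by apply: same_cone v00 u2 v2; exact: cone_form_timelike.
Qed.

Lemma future_coneZ v0 t u : 0 < t -> future_cone v0 u -> future_cone v0 (t *: u).
Proof.
by move=> t0 [u1 u2]; split; rewrite ?cone_formZ ?bilE mulr_gt0 ?exprn_gt0.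
Qed.

Lemma future_cone_connected v0 : 0 < bil q v0 v0 -> connected (future_cone v0).
Proof.
move=> v00; apply: convex_cone_connected => [u v|t u].
  exact: future_coneD.
exact: future_coneZ.
Qed.

Lemma future_half_cone_connected v0 : 0 < bil q v0 v0 ->
  connected (future_cone v0 `&` [set v | 0 < lin c v]).
Proof.
move=> v00; apply: convex_cone_connected => [u v [u1 u2] [v1 v2]|t u t0 [u1 u2]].
  by split; [exact: future_coneD|rewrite /= linD addr_gt0].
by split; [exact: future_coneZ|rewrite /= linZ mulr_gt0].
Qed.

Lemma future_cone_component v0 v : 0 < bil q v0 v0 -> future_cone v0 v ->
  connected_component [set w | 0 < cone_form q c k m w] v = future_cone v0.
Proof.
move=> v00 vW; apply: component_clopen => //; first exact: future_cone_connected.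
- exists [set v | 0 < bil q v0 v]; last by [].
  apply: (@open_comp _ _ (fun w => bil q v0 w : R^o) [set y | 0 < y]) => [w _|].
    exact: bil_continuous.
  exact: open_gt.
- exists [set v | 0 <= bil q v0 v].
    apply: (@closed_comp _ _ (fun w => bil q v0 w : R^o) [set y | 0 <= y]) => [w _|].
      exact: bil_continuous.
    exact: closed_ge.
  apply/seteqP; split => w /= [w1 w2]; split => //; first exact: ltW.
  by rewrite lt_def w2 timelike_bil_neq0// cone_form_timelike.
Qed.

End TimeCones.

(** * Boundary behaviour in a fibre *)

Section KundtContinuity.
Context {R : realType} {n : nat}.
Variables (q : 'M[R]_n) (c : 'cV[R]_n) (p k m : R).
Implicit Types u v w : 'rV[R]_n.

Lemma lin_neq0_open : open [set v | lin c v != 0].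
Proof.
by apply: (@open_comp _ _ (lin c : _ -> R^o) [set x | x != 0]) => [x _|];
  [exact: lin_continuous|exact: open_neq].
Qed.

Lemma powR_linsq_smooth r :
  smooth_on [set v | lin c v != 0] (fun v => (lin c v ^+ 2) `^ r : R^o).
Proof.
move=> N; apply: Ck_powR; first exact: lin_neq0_open.
  by move=> v /= v0; rewrite exprn_even_gt0.
exact/linsq_smooth/lin_neq0_open.
Qed.

Lemma kundt_form_smooth : smooth_on (kundt_region q c k m)
  (kundt_form q c p k m : _ -> R^o).
Proof.
have oU := @kundt_region_open R n q c k m.
move=> N; apply: Ck_mul => //.
  by apply: Ck_sub (powR_linsq_smooth _ _) => v [].
by apply: Ck_powR => //; [move=> v []|exact: cone_form_smooth].
Qed.

Lemma kundt_form_continuous v : kundt_region q c k m v ->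
  {for v, continuous (kundt_form q c p k m : _ -> R^o)}.
Proof. exact: (kundt_form_smooth 0%N). Qed.

Lemma near_gt (f : 'rV[R]_n -> R^o) v (e : R) : {for v, continuous f} -> e < f v ->
  \forall w \near v, e < f w.
Proof. by move=> /cvgr_gt cf ef; exact: cf. Qed.

Lemma near_lt (f : 'rV[R]_n -> R^o) v (e : R) : {for v, continuous f} -> f v < e ->
  \forall w \near v, f w < e.
Proof. by move=> /cvgr_lt cf ef; exact: cf. Qed.

End KundtContinuity.

(** * Necessary conditions on m, k and p, for K a fibre of T *)

Section Necessity.
Context {R : realType} {n : nat}.
Variables (q : 'M[R]_n) (c : 'cV[R]_n) (p k m : R) (K : set 'rV[R]_n).
Hypotheses (lq : lorentzian q) (n2 : (2 < n)%N) (m_neq0 : m != 0).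
Hypotheses (oK : open K) (K0 : K !=set0).
Hypothesis KD : forall v, K v ->
  [/\ 0 < bil q v v, lin c v != 0 & 0 < cone_form q c k m v].
Hypothesis Kext : {within closure K, continuous
  (fun v => if v \in K then kundt_form q c p k m v else 0 : R)}.
Implicit Types u v w : 'rV[R]_n.

Let qT := lorentzian_sym lq.

Let D : set 'rV[R]_n :=
  [set v | [/\ 0 < bil q v v, lin c v != 0 & 0 < cone_form q c k m v]].

Lemma boundary_lt w (e : R) : closure K w -> ~ K w -> 0 < e ->
  \forall v \near w, K v -> kundt_form q c p k m v < e.
Proof.
move=> cKw nKw e0; have /subspace_continuousP/(_ w cKw) := Kext.
rewrite /from_subspace /= memNset// => /cvgr_lt /(_ e e0).
rewrite near_withinE; apply: filterS => v h Kv.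
by move: (h (subset_closure Kv)); rewrite mem_set.
Qed.

(** L is continuous and positive at such a w, while its extension would vanish there if w were
    outside K. The sign of A at w is left free so as to reach vectors with A = 0. *)
Lemma boundary_region w : closure K w -> lin c w != 0 ->
  0 < cone_form q c k m w -> K w.
Proof.
move=> cKw B0 C0; apply: contrapT => nKw.
have F0 : 0 < kundt_form q c p k m w by exact: kundt_form_gt0.
have F2 : 0 < kundt_form q c p k m w / 2 by rewrite divr_gt0.
have cF := @kundt_form_continuous R n q c p k m w (conj B0 C0).
have h1 := boundary_lt cKw nKw F2.
have h2 : \forall v \near w, kundt_form q c p k m w / 2 < kundt_form q c p k m v.
  by apply: (near_gt cF); rewrite gtr_pMr// invf_lt1// ltr1n.
have [v [Kv [/(_ Kv) v1 v2]]] := cKw _ (filterI h1 h2).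
by have := lt_trans v1 v2; rewrite ltxx.
Qed.

Lemma closure_region_sub : closure K `&` D `<=` K.
Proof. by move=> w [cKw [_ B0 C0]]; exact: boundary_region. Qed.

(* Moving v in the direction u keeps B and lets A decrease from bil q v v, by
   any prescribed amount r at time 1. *)
Lemma exists_transversal v (r : R) : 0 < bil q v v -> 0 < r ->
  exists u, [/\ bil q v u = 0, lin c u = 0 & bil q u u = - r].
Proof.
move=> v0 r0; have [u [u0 vu cu]] := exists_orth_ker c lq v n2.
have uu := lorentzian_orth_lt0 lq v0 vu u0.
have h : 0 <= r / - bil q u u by rewrite divr_ge0 ?oppr_ge0// ltW.
exists (Num.sqrt (r / - bil q u u) *: u); split; rewrite !bilE ?vu ?cu ?mulr0//.
by rewrite mulrA -expr2 sqr_sqrtr//; field; rewrite lt_eqF.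
Qed.

Lemma kundt_signs : m < 0 /\ 0 < k.
Proof.
have [v Kv] := K0; have [A0 B0 C0] := KD Kv.
have m0 : m < 0.
  rewrite ltNge; apply/negP; rewrite le_eqVlt eq_sym (negPf m_neq0) /= => m0.
  have mB : 0 < m * lin c v ^+ 2 by rewrite mulr_gt0// exprn_even_gt0.
  (* With r = A(v), A reaches 0 at time 1, where C = m B^2 is still positive. Then [boundary_region]
     puts the end point in K, where A must be positive. *)
  have [u [vu cu uu]] := exists_transversal A0 A0.
  have At (t : R) : bil q (v + t *: u) (v + t *: u) = (1 - t ^+ 2) * bil q v v.
    by rewrite !bilE (bilC u v qT) vu uu; ring.
  have Bt (t : R) : lin c (v + t *: u) = lin c v by rewrite !bilE cu mulr0 addr0.
  have Ct (t : R) : cone_form q c k m (v + t *: u) =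
      (1 - t ^+ 2) * cone_form q c k m v + t ^+ 2 * (m * lin c v ^+ 2).
    by rewrite /cone_form At Bt; ring.
  have [t|_ cKw] := half_segment_sub (v := v) (u := u) oK closure_region_sub Kv.
    move=> /andP[t0 t1]; have t2 : 0 < 1 - t ^+ 2.
      by rewrite subr_gt0 expr_lt1.
    split; rewrite ?At ?Bt ?Ct ?mulr_gt0//.
    apply: ltr_wpDr; last by rewrite mulr_gt0.
    by rewrite mulr_ge0 ?sqr_ge0// ltW.
  have /KD[] : K (v + u).
    rewrite -[u]scale1r in cKw *; apply: boundary_region; rewrite ?Bt ?Ct//.
    by rewrite expr1n subrr mul0r add0r mul1r.
  by rewrite -[u]scale1r At expr1n subrr mul0r ltxx.
split=> //; move: C0; rewrite /cone_form => C0; rewrite -(pmulr_lgt0 _ A0).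
have : m * lin c v ^+ 2 <= 0 by rewrite nmulr_rle0 ?sqr_ge0.
lra.
Qed.

Let m0 := kundt_signs.1.
Let k0 := kundt_signs.2.

(** Lowering A by C(v) / k with B fixed ends exactly on C = 0. The last equation records that A(w) <
    A(v), which [exponent_le1] uses to obtain a strict inequality. *)
Lemma exists_cone_boundary : exists v w, [/\ K v, closure K w, lin c w = lin c v,
  cone_form q c k m w = 0 & k * bil q w w = k * bil q v v - cone_form q c k m v].
Proof.
have [v Kv] := K0; have [A0 B0 C0] := KD Kv.
have [u [vu cu uu]] := exists_transversal A0 (divr_gt0 C0 k0).
have k0' : k != 0 by rewrite gt_eqF.
have At (t : R) : k * bil q (v + t *: u) (v + t *: u) =
    k * bil q v v - t ^+ 2 * cone_form q c k m v.
  by rewrite !bilE (bilC u v qT) vu uu; field.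
have Bt (t : R) : lin c (v + t *: u) = lin c v by rewrite !bilE cu mulr0 addr0.
have Ct (t : R) : cone_form q c k m (v + t *: u) =
    (1 - t ^+ 2) * cone_form q c k m v.
  by rewrite {1}/cone_form At Bt {2}/cone_form; rewrite /cone_form; ring.
have [t|_ cKw] := half_segment_sub (v := v) (u := u) oK closure_region_sub Kv.
  move=> /andP[t0 t1]; have t2 : 0 < 1 - t ^+ 2 by rewrite subr_gt0 expr_lt1.
  have Ct0 : 0 < cone_form q c k m (v + t *: u) by rewrite Ct mulr_gt0.
  by split; rewrite ?Bt//; exact: (cone_form_timelike k0 m0 Ct0).
exists v, (v + u); rewrite -[u]scale1r Bt Ct At expr1n subrr mul0r mul1r.
by rewrite scale1r.
Qed.

Lemma boundary_notin w : cone_form q c k m w = 0 -> ~ K w.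
Proof. by move=> Cw /KD[_ _]; rewrite Cw ltxx. Qed.

Lemma exponent_gtN1 : -1 < p.
Proof.
rewrite ltNge; apply/negP => p1.
have [v [w [Kv cKw Bw Cw Aw]]] := exists_cone_boundary.
have [A0 B0 C0] := KD Kv; have B0w : lin c w != 0 by rewrite Bw.
have F0 : 0 < (lin c w ^+ 2) `^ (- p) by rewrite powR_gt0// exprn_even_gt0.
(* Near w one has 0 < C < 1 on K, so p + 1 <= 0 gives C^(p+1) >= 1, and L stays above half the value
   of (B^2)^(-p) at w. *)
have h1 := boundary_lt cKw (boundary_notin Cw) (divr_gt0 F0 (ltr0Sn R 1)).
have h2 := near_lt (@cone_form_continuous R n q c k m w) (e := 1).
have h3 := near_gt (@powR_linsq_smooth R n c (- p) 0%N w B0w)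
  (e := (lin c w ^+ 2) `^ (- p) / 2).
have [||x [Kx [[x2 x3] /(_ Kx)]]] := cKw _ (filterI (filterI (h2 _) (h3 _)) h1).
- by rewrite Cw ltr01.
- by rewrite gtr_pMr// invf_lt1// ltr1n.
apply/negP; rewrite -leNgt (le_trans (ltW x3))// /kundt_form.
have [Ax Bx Cx] := KD Kx; rewrite ler_peMr ?powR_ge0//.
rewrite -[leLHS](powRr0 (cone_form q c k m x)); apply: ger_powR; last lra.
by rewrite Cx ltW.
Qed.

(** Where C = 0 the discriminant reduces to k (1 - p) (B^2 - n A). For p > 1 this is negative at w,
    hence at nearby vectors of K, against the Lorentzian signature. *)
Lemma exponent_le1 :
  (forall v, K v -> lorentzian (kundt_metric q c p k m v)) -> p <= 1.
Proof.
move=> Kl; rewrite leNgt; apply/negP => p1.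
have [v [w [Kv cKw Bw Cw Aw]]] := exists_cone_boundary.
have [A0 B0 C0] := KD Kv.
have B2 : 0 < lin c v ^+ 2 by rewrite exprn_even_gt0.
(* For n <= 0, A(w) >= 0 suffices. For n > 0, strictness comes from A(w) < A(v), as B(w) = B(v) and
   n A(v) <= B(v)^2. *)
have nB : conorm q c * bil q w w < lin c w ^+ 2.
  rewrite Bw; have [n0|n0] := lerP (conorm q c) 0.
    apply: le_lt_trans B2; rewrite mulr_le0_ge0// -(pmulr_rge0 _ k0).
    move: Cw; rewrite /cone_form Bw.
    have : m * lin c v ^+ 2 <= 0 by rewrite nmulr_rle0 ?sqr_ge0.
    lra.
  apply: lt_le_trans (lin_gt_conorm c lq A0); rewrite ltr_pM2l//.
  by rewrite -(ltr_pM2l k0) Aw gtrDl oppr_lt0.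
have cst r : Ck 0 setT (cst r : 'rV[R]_n -> R^o) by exact: Ck_cst.
pose f x : R^o := lin c x ^+ 2 + - conorm q c * bil q x x.
have Cf : Ck 0 setT f.
  exact: (Ck_add openT (linsq_smooth c openT 0%N)
    (Ck_mul openT (cst (- conorm q c)) (quad_smooth q openT 0%N))).
have cf : {for w, continuous f} by exact: Cf.
have dE x : kundt_discriminant q c p k m x =
    k * (1 - p) * f x + conorm q c * cone_form q c k m x.
  by rewrite /kundt_discriminant /f mulNr.
have Cd : Ck 0 setT (kundt_discriminant q c p k m : _ -> R^o).
  apply: (Ck_eq openT (fun x _ => esym (dE x))).
  exact: (Ck_add openT (Ck_mul openT (cst (k * (1 - p))) Cf)
    (Ck_mul openT (cst (conorm q c)) (cone_form_smooth q c k m openT 0%N))).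
have cd : {for w, continuous (kundt_discriminant q c p k m : _ -> R^o)}.
  exact: Cd.
have h1 : \forall x \near w, 0 < f x by apply: (near_gt cf); rewrite /f mulNr subr_gt0.
have h2 : \forall x \near w, kundt_discriminant q c p k m x < 0.
  apply: (near_lt cd); rewrite /kundt_discriminant Cw mulr0 addr0.
  by rewrite pmulr_llt0 ?subr_gt0// pmulr_rlt0// subr_lt0.
have [x [Kx [x1 x2]]] := cKw _ (filterI h1 h2); have [Ax Bx Cx] := KD Kx.
have := kundt_discriminant_ge0 lq Ax Bx Cx k0 exponent_gtN1 (Kl x Kx).
by rewrite -subr_gt0 -mulNr => /(_ x1); rewrite leNgt x2.
Qed.

Lemma exponent_lt0 : conorm q c < 0 -> p < 0.
Proof.
move=> n0; rewrite ltNge; apply/negP => p0.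
have [v Kv] := K0; have [A0 B0 C0] := KD Kv.
have n0' : conorm q c != 0 by rewrite lt_eqF.
have B2 : 0 < lin c v ^+ 2 by rewrite exprn_even_gt0.
(* Along v + t u, B goes linearly to 0 at t = 1, while A grows because n < 0. Hence C stays
   positive, and the end point is excluded from K only by B = 0. *)
pose u := - (lin c v / conorm q c) *: sharp q c.
have At (t : R) : bil q (v + t *: u) (v + t *: u) =
    bil q v v + (lin c v ^+ 2 / - conorm q c) * (t * (2 - t)).
  rewrite /u !bilE (bilC (sharp q c) v qT) !bil_sharp// lin_sharp//.
  by field.
have Bt (t : R) : lin c (v + t *: u) = (1 - t) * lin c v.
  by rewrite /u !bilE lin_sharp//; field.
have s0 : 0 <= lin c v ^+ 2 / - conorm q c by rewrite divr_ge0 ?sqr_ge0// oppr_ge0 ltW.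
have At0 (t : R) : 0 <= t <= 1 -> bil q v v <= bil q (v + t *: u) (v + t *: u).
  by move=> /andP[t0 t1]; rewrite At lerDl mulr_ge0// mulr_ge0//; lra.
have Ct0 (t : R) : 0 <= t <= 1 -> 0 < cone_form q c k m (v + t *: u).
  move=> t01; have := At0 t t01; rewrite -(ler_pM2l k0) => h.
  move: C0; rewrite /cone_form Bt exprMn => C0.
  apply: lt_le_trans C0 _; apply: lerD => //.
  rewrite ler_nM2l// ler_piMl ?(ltW B2)//; case/andP: t01 => t0 t1.
  by rewrite expr_le1//; lra.
have [t|_ cKw] := half_segment_sub (v := v) (u := u) oK closure_region_sub Kv.
  move=> /andP[t0 t1]; have t01 : 0 <= t <= 1 by rewrite t0 ltW.
  split; [exact: lt_le_trans (At0 _ t01)|rewrite Bt|exact: Ct0].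
  by rewrite mulf_neq0// gt_eqF// subr_gt0.
have C1 : 0 < cone_form q c k m (v + u).
  by have := Ct0 1; rewrite scale1r lexx ler01; apply.
have B1 : lin c (v + u) = 0 by rewrite -[u]scale1r Bt subrr mul0r.
have nK : ~ K (v + u) by move=> /KD[_]; rewrite B1 eqxx.
have p1 : 0 <= p + 1 by rewrite addr_ge0.
(* Near the end point B^2 < 1, so p >= 0 gives (B^2)^(-p) >= 1 and L >= C^(p+1), which stays above
   this bound. *)
have e0 : 0 < (cone_form q c k m (v + u) / 2) `^ (p + 1) by rewrite powR_gt0// divr_gt0.
have h1 := boundary_lt cKw nK e0.
have h2 := near_lt (@linsq_smooth R n c setT openT 0%N (v + u) I) (e := 1).
have h3 := near_gt (@cone_form_continuous R n q c k m (v + u))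
  (e := cone_form q c k m (v + u) / 2).
have [||x [Kx [[x2 x3] /(_ Kx)]]] := cKw _ (filterI (filterI (h2 _) (h3 _)) h1).
- by rewrite B1 expr0n ltr01.
- by rewrite gtr_pMr// invf_lt1// ltr1n.
have [Ax Bx Cx] := KD Kx; apply/negP; rewrite -leNgt.
apply: le_trans (_ : cone_form q c k m x `^ (p + 1) <= _).
  by apply: ge0_ler_powR => //; rewrite ?nnegrE ltW// divr_gt0.
rewrite /kundt_form ler_peMl ?powR_ge0// -[leLHS](powRr0 (lin c x ^+ 2)).
apply: ger_powR; rewrite ?oppr_le0//; apply/andP.
by split; [rewrite exprn_even_gt0|exact: ltW].
Qed.

End Necessity.

(** * Identification of the fibres of T *)

Section Identification.
Context {R : realType} {n : nat}.
Variables (q : 'M[R]_n) (c : 'cV[R]_n) (k m : R) (K : set 'rV[R]_n) (v0 : 'rV[R]_n).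
Hypotheses (lq : lorentzian q) (k0 : 0 < k) (m0 : m < 0).
Hypotheses (oK : open K) (cK : connected K) (v00 : 0 < bil q v0 v0).
Hypothesis KD : forall v, K v ->
  [/\ 0 < bil q v v, lin c v != 0 & 0 < cone_form q c k m v].
Hypothesis Kclosed : closure K `&`
  [set v | [/\ 0 < bil q v v, lin c v != 0 & 0 < cone_form q c k m v]] `<=` K.
Hypothesis Kv0 : exists2 v, K v & 0 < bil q v0 v.

Lemma sub_future_cone : K `<=` future_cone q c k m v0.
Proof.
have [v Kv vv0] := Kv0; have [_ _ Cv] := KD Kv.
have vW : future_cone q c k m v0 v by [].
rewrite -(future_cone_component lq k0 m0 v00 vW).
by apply: connected_component_max => // w /KD[].
Qed.

(** For n >= 0, B has no zero on timelike vectors, so the connected future cone lies in the domain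
    of L, where K is clopen. *)
Lemma eq_future_cone : c != 0 -> 0 <= conorm q c -> K = future_cone q c k m v0.
Proof.
move=> c0 n0; apply/seteqP; split; first exact: sub_future_cone.
apply: connected_sub_clopen oK Kclosed _ _ _.
- exact: future_cone_connected.
- move=> v [Cv _]; have Av := cone_form_timelike k0 m0 Cv.
  by split=> //; exact: lin_neq0 Av.
by have [v Kv vv0] := Kv0; exists v; split=> //; exact: sub_future_cone.
Qed.

(** Restricting to B > 0 keeps the convex cone inside the domain of L, whatever the sign of n. *)
Lemma eq_future_half_cone : (forall v, K v -> 0 < lin c v) ->
  K = future_cone q c k m v0 `&` [set v | 0 < lin c v].
Proof.
move=> K0; apply/seteqP; split=> [v Kv|].
  by split; [exact: sub_future_cone|exact: K0].
apply: connected_sub_clopen oK Kclosed _ _ _.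
- exact: future_half_cone_connected.
- move=> v [[Cv _] Bv]; have Av := cone_form_timelike k0 m0 Cv.
  by split=> //; rewrite gt_eqF.
have [v Kv vv0] := Kv0; exists v; split=> //; split; last exact: K0.
exact: sub_future_cone.
Qed.

End Identification.

(** * Decay of L at the boundary of the cones *)

Section Boundary.
Context {R : realType} {n : nat}.
Variables (q : 'M[R]_n) (c : 'cV[R]_n) (p k m : R).
Hypotheses (lq : lorentzian q) (k0 : 0 < k) (m0 : m < 0).
Implicit Types u v w : 'rV[R]_n.

Let qT := lorentzian_sym lq.
Local Notation C := (cone_form q c k m).
Local Notation F := (kundt_form q c p k m).

Lemma powR_small (r e : R) : 0 < r -> 0 < e ->
  exists2 d, 0 < d & forall x, 0 <= x < d -> x `^ r < e.
Proof.
move=> r0 e0; exists (e `^ r^-1); first exact: powR_gt0.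
move=> x /andP[x0 xd].
have := gt0_ltr_powR r0; move=> /(_ x (e `^ r^-1)); rewrite !nnegrE x0 powR_ge0.
by move=> /(_ isT isT xd); rewrite -powRrM mulVf ?gt_eqF// powRr1// ltW.
Qed.

Lemma linsq_continuous : continuous (fun v => lin c v ^+ 2 : R^o).
Proof. by move=> v; exact: (@linsq_smooth R n c setT openT 0%N v I). Qed.

Lemma kundt_small_region w (e : R) : -1 < p -> lin c w != 0 -> C w <= 0 -> 0 < e ->
  \forall v \near w, 0 < C v -> F v < e.
Proof.
move=> p1 Bw Cw e0; have p10 : 0 < p + 1 by lra.
pose N := (lin c w ^+ 2) `^ (- p) + 1.
have N0 : 0 < N by rewrite ltr_wpDl ?powR_ge0.
have [d d0 dP] := powR_small p10 (divr_gt0 e0 N0).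
have h1 : \forall v \near w, (lin c v ^+ 2) `^ (- p) < N.
  apply: (near_lt (@powR_linsq_smooth R n c (- p) 0%N w Bw)).
  by rewrite /N ltrDl ltr01.
have h2 : \forall v \near w, C v < d.
  by apply: (near_lt (@cone_form_continuous R n q c k m w)); exact: le_lt_trans d0.
near=> v => Cv; have vN : (lin c v ^+ 2) `^ (- p) < N by near: v.
have /dP Ce : 0 <= C v < d by rewrite ltW//=; near: v.
rewrite /kundt_form -[ltRHS](divfK (lt0r_neq0 N0)) [ltRHS]mulrC.
apply: ltr_pM => //; exact: powR_ge0.
Unshelve. all: by end_near. Qed.

(** Both exponents -p and p + 1 are positive: L is small as soon as one of B^2 and C is small, the
    other factor being locally bounded. *)
Lemma kundt_small_neg w (e : R) : -1 < p -> p < 0 -> lin c w = 0 \/ C w <= 0 -> 0 < e ->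
  \forall v \near w, 0 < C v -> F v < e.
Proof.
move=> p1 p0; have [Bw|Bw] := eqVneq (lin c w) 0; last first.
  by case=> [Bw0|]; [rewrite Bw0 eqxx in Bw|exact: kundt_small_region].
move=> _ e0; have p10 : 0 < p + 1 by lra.
have np0 : 0 < - p by rewrite oppr_gt0.
pose N := (`|C w| + 1) `^ (p + 1).
have N0 : 0 < N by rewrite powR_gt0// ltr_wpDl.
have [d d0 dP] := powR_small np0 (divr_gt0 e0 N0).
have h1 : \forall v \near w, lin c v ^+ 2 < d.
  by apply: (near_lt (@linsq_continuous w)); rewrite Bw expr0n.
have h2 : \forall v \near w, C v < `|C w| + 1.
  apply: (near_lt (@cone_form_continuous R n q c k m w)).
  by rewrite (le_lt_trans (ler_norm _))// ltrDl ltr01.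
near=> v => Cv.
have /dP Be : 0 <= lin c v ^+ 2 < d by rewrite sqr_ge0 /=; near: v.
have CN : C v `^ (p + 1) < N.
  apply: gt0_ltr_powR => //; [by rewrite nnegrE ltW|by rewrite nnegrE addr_ge0|].
  by near: v.
rewrite /kundt_form -[ltRHS](divfK (lt0r_neq0 N0)).
apply: ltr_pM => //; exact: powR_ge0.
Unshelve. all: by end_near. Qed.

Lemma cone_form_le v : C v <= k * bil q v v.
Proof. by rewrite gerDl nmulr_rle0 ?sqr_ge0. Qed.

(* With lin c u = 1, the vector v - B u lies in the kernel of c, where the metric
   is negative semidefinite; expand and use bil q (v - B u) (v - B u) <= 0. *)
Lemma near_ker_bound w : c != 0 -> 0 <= conorm q c ->
  exists2 H, 0 < H & \forall v \near w, bil q v v <= H * `|lin c v|.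
Proof.
move=> c0 n0.
have [u cu] : exists u, lin c u = 1.
  have /existsP[i ci] : [exists i, c i 0 != 0].
    apply: contraNT c0 => /existsPn h; apply/eqP/colP => i.
    by rewrite mxE; apply/eqP; have := h i; rewrite negbK.
  by exists ((c i 0)^-1 *: delta_mx 0 i); rewrite linZ lin_delta mulVf.
pose x0 := (2 : R) *: u.
pose h v : R^o := bil q x0 v + - bil q u u * lin c v.
have ch : {for w, continuous h}.
  have C1 : Ck 0 setT (fun v => bil q x0 v : R^o).
    by move=> v _; exact: (bil_continuous lq).
  have C2 := Ck_mul openT (Ck_cst 0 setT (- bil q u u : R^o)) (lin_smooth c openT 0%N).
  have Ch : Ck 0 setT h by exact: (Ck_add openT C1 C2).
  exact: Ch.
exists (`|h w| + 1); first by rewrite ltr_wpDl.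
have h1 : \forall v \near w, h v < `|h w| + 1.
  by apply: (near_lt ch); rewrite (le_lt_trans (ler_norm _))// ltrDl ltr01.
have h2 : \forall v \near w, - (`|h w| + 1) < h v.
  apply: (near_gt ch); rewrite ltrNl (le_lt_trans (ler_norm _))// normrN.
  by rewrite ltrDl ltr01.
near=> v; have hv : `|h v| <= `|h w| + 1.
  by rewrite ler_norml; apply/andP; split; apply: ltW; near: v.
apply: le_trans (_ : h v * lin c v <= _); last first.
  by rewrite (le_trans (ler_norm _))// normrM ler_wpM2r.
have := @ker_le0 _ _ q c lq (v - lin c v *: u) c0 n0.
rewrite !bilE cu mulr1 subrr => /(_ erefl).
by rewrite /h /x0 !bilE (bilC u v qT); lra.
Unshelve. all: by end_near. Qed.

(** Since C <= k A, for p < 1 the bound A <= H |B| gives L <= (k H)^(p+1) |B|^(1-p). For p = 1 that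
    power is constant, and n A <= B^2 is used instead: L = C^2 / B^2 <= (k / n)^2 B^2. *)
Lemma kundt_small_causal w (e : R) : c != 0 -> 0 <= conorm q c ->
  0 <= p <= 1 -> (p = 1 -> conorm q c != 0) -> lin c w = 0 -> 0 < e ->
  \forall v \near w, 0 < C v -> F v < e.
Proof.
move=> c0 n0 /andP[p0 p1] pn Bw e0.
have p10 : 0 < p + 1 by lra.
have [p1e|pn1] := eqVneq p 1.
  have n1 : 0 < conorm q c by rewrite lt_def n0 pn.
  have d0 : 0 < e / (k / conorm q c) ^+ 2 by rewrite divr_gt0// exprn_gt0// divr_gt0.
  have h1 : \forall v \near w, lin c v ^+ 2 < e / (k / conorm q c) ^+ 2.
    by apply: (near_lt (@linsq_continuous w)); rewrite Bw expr0n.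
  near=> v => Cv; have Av := cone_form_timelike k0 m0 Cv.
  have B1 := lin_neq0 lq c0 n0 Av.
  have B2 : 0 < lin c v ^+ 2 by rewrite exprn_even_gt0.
  have Bd : lin c v ^+ 2 < e / (k / conorm q c) ^+ 2 by near: v.
  rewrite /kundt_form p1e powR_inv1 ?ltW// (_ : 1 + 1 = 2%:R)//.
  rewrite powR_mulrn ?ltW// mulrC ltr_pdivrMr//.
  apply: le_lt_trans (_ : (k / conorm q c * lin c v ^+ 2) ^+ 2 < _).
    have kn : 0 <= k / conorm q c * lin c v ^+ 2.
      by rewrite mulr_ge0 ?sqr_ge0// divr_ge0 ?ltW.
    rewrite ler_sqr ?nnegrE ?(ltW Cv)//.
    rewrite (le_trans (cone_form_le v))// -mulrA ler_pM2l// mulrC.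
    by rewrite ler_pdivlMr// mulrC lin_gt_conorm.
  rewrite exprMn [lin c v ^+ 2 ^+ 2]expr2 mulrA ltr_pM2r//.
  by rewrite mulrC -ltr_pdivlMr// exprn_gt0// divr_gt0.
have p1' : 0 < 1 - p by rewrite subr_gt0 lt_neqAle pn1.
have [H H0 hH] := near_ker_bound w c0 n0.
have N0 : 0 < (k * H) `^ (p + 1) by rewrite powR_gt0// mulr_gt0.
have [d d0 dP] := powR_small p1' (divr_gt0 e0 N0).
have h1 : \forall v \near w, lin c v < d.
  by apply: (near_lt (@lin_continuous _ _ c w)); rewrite Bw.
have h2 : \forall v \near w, - d < lin c v.
  by apply: (near_gt (@lin_continuous _ _ c w)); rewrite Bw oppr_lt0.
near=> v => Cv; have Av := cone_form_timelike k0 m0 Cv.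
have B0 : 0 < `|lin c v| by rewrite normr_gt0 (lin_neq0 lq c0 n0 Av).
have /dP Bd : 0 <= `|lin c v| < d.
  by rewrite normr_ge0 /= ltr_norml; apply/andP; split; near: v.
have AH : bil q v v <= H * `|lin c v| by near: v.
apply: le_lt_trans (_ : (k * H) `^ (p + 1) * `|lin c v| `^ (1 - p) < _); last first.
  by rewrite mulrC -ltr_pdivlMr.
have -> : `|lin c v| `^ (1 - p) = (lin c v ^+ 2) `^ (- p) * `|lin c v| `^ (p + 1).
  rewrite -real_normK ?num_real// -powR_mulrn ?ltW// -powRrM -powRD.
    by congr (_ `^ _); ring.
  by apply/implyP => _; rewrite gt_eqF.
rewrite mulrCA -powRM ?(ltW B0) ?mulr_ge0 ?(ltW k0) ?(ltW H0)//.
rewrite /kundt_form ler_wpM2l ?powR_ge0//.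
apply: ge0_ler_powR; [exact: ltW|by rewrite nnegrE ltW| |].
  by rewrite nnegrE !mulr_ge0// ltW.
by rewrite (le_trans (cone_form_le v))// -mulrA ler_pM2l.
Unshelve. all: by end_near. Qed.

Lemma kundt_extension (K : set 'rV[R]_n) : open K ->
  (forall v, K v -> lin c v != 0 /\ 0 < C v) ->
  (forall w (e : R), closure K w -> ~ K w -> 0 < e ->
    \forall v \near w, K v -> F v < e) ->
  {within closure K, continuous (fun v => if v \in K then F v else 0 : R)}.
Proof.
move=> oK KD Kb; apply/subspace_continuousP => w cKw.
have [Kw|nKw] := pselect (K w).
  rewrite /from_subspace /= mem_set//; apply: cvg_within_filter.
  apply: cvg_trans (@kundt_form_continuous R n q c p k m w (KD w Kw)).
  by apply: near_eq_cvg; apply: near_open oK Kw _ => v Kv; rewrite mem_set.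
rewrite /from_subspace /= memNset//; apply: cvg_within_filter.
apply/cvgrPdist_lt => e e0; have := Kb w e cKw nKw e0.
apply: filterS => v h; rewrite sub0r normrN.
case: ifPn => [/set_mem Kv|_]; last by rewrite normr0.
have [v1 v2] := KD v Kv.
by rewrite gtr0_norm ?h//; exact: kundt_form_gt0.
Qed.

End Boundary.

(** * Topology of the tangent bundle *)

Section Frames.
Context {R : realType} {d : nat} (M : manifold R d).
Implicit Types (i j : chart M) (y : 'rV[R]_d).

Lemma mulmx_jacobian n l (f : 'rV[R]_n -> 'rV[R]_l) x u :
  u *m jacobian f x = 'd f x u.
Proof. by rewrite /jacobian mul_rV_lin1. Qed.

Lemma eq_mulmxl n l (A B : 'M[R]_(n, l)) :
  (forall u : 'rV[R]_n, u *m A = u *m B) -> A = B.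
Proof. by move=> AB; apply/row_matrixP => r; rewrite 2!rowE. Qed.

Lemma cod_psi i y : cod i y -> dom i (psi i y) /\ phi i (psi i y) = y.
Proof. by case=> x dx <-; rewrite phiK. Qed.

Lemma open_cod_psi i (U : set M) : open U -> open (cod i `&` psi i @^-1` U).
Proof.
move=> oU; rewrite openE => y [cy Uy]; apply: filterI.
  exact: (open_nbhs_nbhs (conj (@cod_open _ _ M i) cy)).
exact: (psi_continuous cy (open_nbhs_nbhs (conj oU Uy))).
Qed.

Lemma overlapE i j : phi i @` (dom i `&` dom j) = cod i `&` psi i @^-1` dom j.
Proof.
apply/seteqP; split=> [_ [x [di dj] <-]|y [cy dj]].
  by split; [exists x|rewrite /= phiK].
by have [di e] := cod_psi cy; exists (psi i y).
Qed.

Lemma overlap_open i j : open (cod i `&` psi i @^-1` dom j).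
Proof. exact/open_cod_psi/dom_open. Qed.

Lemma transition_Ck i j n : Ck n (cod i `&` psi i @^-1` dom j) (phi j \o psi i).
Proof. by rewrite -overlapE; exact: transition_smooth. Qed.

Lemma transition_diff i j y : cod i y -> dom j (psi i y) ->
  differentiable (phi j \o psi i) y.
Proof. by move=> cy dy; have [+ _] := transition_Ck i j 1; apply. Qed.

Lemma frame_chain i j y : cod i y -> dom j (psi i y) ->
  frame i y = jacobian (phi j \o psi i) y *m frame j (phi j (psi i y)).
Proof.
move=> cy dy; rewrite /frame phiK//; set x := psi i y; set l := chart_at x.
have dl : dom l x by exact: dom_chart_at.
have cj : cod j (phi j x) by exists x.
have d1 := transition_diff cy dy.
have d2 : differentiable (phi l \o psi j) (phi j x).
  by apply: transition_diff => //; rewrite phiK.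
have e : {near y, (phi l \o psi j) \o (phi j \o psi i) =1 phi l \o psi i}.
  have oy := @overlap_open i j.
  by apply: (near_open oy (conj cy dy)) => z [_ dz] /=; rewrite phiK.
have [_ de] := near_eq_is_diff e (differentiable_comp d1 d2).
apply: eq_mulmxl => u; rewrite mulmxA [LHS]mulmx_jacobian.
rewrite [X in _ = X *m _]mulmx_jacobian [RHS]mulmx_jacobian.
exact: (etrans (congr1 (@^~ u) de) (congr1 (@^~ u) (diff_comp d1 d2))).
Qed.

Lemma frame_chart_at (x : M) :
  frame (chart_at x) (phi (chart_at x) x) = 1%:M.
Proof.
have dx := dom_chart_at x; rewrite /frame phiK//; set i := chart_at x.
have cx : cod i (phi i x) by exists x.
have e : {near phi i x, id =1 phi i \o psi i}.
  by apply: (near_open (@cod_open _ _ M i) cx) => z cz /=; have [_ ->] := cod_psi cz.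
have [_ de] := near_eq_is_diff e (ex_diff (is_diff_def := is_diff_id _)).
apply: eq_mulmxl => u; rewrite mulmx1 mulmx_jacobian.
by rewrite (congr1 (@^~ u) de) diff_val.
Qed.

(** The frame of [chart_at x] at its own point x is the identity; by the chain rule through the
    chart i it has [frame i y] as a factor. *)
Lemma frame_unit i y : cod i y -> frame i y \in unitmx.
Proof.
move=> cy; have [di e] := cod_psi cy; set x := psi i y in di e.
have cx : cod (chart_at x) (phi (chart_at x) x).
  by exists x => //; exact: dom_chart_at.
have := frame_chart_at x; rewrite (@frame_chain _ i)//; last first.
  by rewrite phiK//; exact: dom_chart_at.
rewrite phiK ?e; last exact: dom_chart_at.
by move/mulmx1_unit => [].
Qed.

End Frames.

(** * Smoothness of forms depending on a point and a vector *)

Section SmoothForms.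
Context {R : realType}.
Implicit Types V W : normedModType R.

Lemma Ck_coord V N m n (U : set V) (f : V -> 'M[R]_(m, n)) i j : open U ->
  Ck N U f -> Ck N U (fun x => f x i j : R^o).
Proof.
move=> oU Cf.
have @g : {linear 'M[R]_(m, n) -> R^o}.
  by exists (fun N : 'M[R]_(_, _) => N i j); do 2![eexists]; do ?[constructor];
     rewrite ?mxE// => ? *; rewrite ?mxE//; move=> ?; rewrite !mxE.
have cg : continuous g by exact: coord_continuous.
exact: (Ck_comp_linear oU cg Cf).
Qed.

Lemma Ck_bil V N n (U : set V) (q : V -> 'M[R]_n) (f g : V -> 'rV[R]_n) :
  open U -> Ck N U q -> Ck N U f -> Ck N U g ->
  Ck N U (fun x => bil (q x) (f x) (g x) : R^o).
Proof.
move=> oU Cq Cf Cg; apply: (Ck_eq oU (f := fun x =>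
    \sum_j (\sum_i f x 0 i * q x i j) * g x 0 j)) => [x _|].
  rewrite /bil mxE; apply: eq_bigr => j _; rewrite !mxE.
  by congr (_ * _); apply: eq_bigr => i _.
apply: Ck_sum => // j; apply: Ck_mul => //; last exact: Ck_coord.
by apply: Ck_sum => // i; apply: Ck_mul => //; exact: Ck_coord.
Qed.

Lemma Ck_lin V N n (U : set V) (c : V -> 'cV[R]_n) (f : V -> 'rV[R]_n) :
  open U -> Ck N U c -> Ck N U f -> Ck N U (fun x => lin (c x) (f x) : R^o).
Proof.
move=> oU Cc Cf; apply: (Ck_eq oU (f := fun x =>
    \sum_i f x 0 i * c x i 0)) => [x _|]; first by rewrite linE.
by apply: Ck_sum => // i; apply: Ck_mul => //; exact: Ck_coord.
Qed.

Lemma Ck_fst V (V' : normedModType R) W N (U : set V) (f : V -> W) : open U -> Ck N U f ->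
  Ck N (fst @^-1` U : set (V * V')) (f \o fst).
Proof.
move=> oU Cf.
exact: (@Ck_precomp_linear R V W _ N U f (fst : {linear (V * V')%type -> V}) oU
  (fun x => cvg_fst) Cf).
Qed.

Lemma Ck_snd V (V' : normedModType R) W N (U : set V') (f : V' -> W) : open U ->
  Ck N U f -> Ck N (snd @^-1` U : set (V * V')) (f \o snd).
Proof.
move=> oU Cf.
exact: (@Ck_precomp_linear R V' W _ N U f (snd : {linear (V * V')%type -> V'}) oU
  (fun x => cvg_snd) Cf).
Qed.

Lemma smooth_fst V (V' : normedModType R) N (U : set (V * V')) : Ck N U fst.
Proof.
exact: (@smooth_on_linear R _ _ U (fst : {linear (V * V')%type -> V}) (fun x => cvg_fst)).
Qed.

Lemma smooth_snd V (V' : normedModType R) N (U : set (V * V')) : Ck N U snd.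
Proof.
exact: (@smooth_on_linear R _ _ U (snd : {linear (V * V')%type -> V'}) (fun x => cvg_snd)).
Qed.

Lemma open_gt0 V (U : set V) (f : V -> R^o) : open U -> Ck 0 U f ->
  open (U `&` [set x | 0 < f x]).
Proof.
move=> oU Cf; rewrite openE => x [Ux fx]; apply: filterI.
  exact: (open_nbhs_nbhs (conj oU Ux)).
by have /cvgr_gt := Cf x Ux; exact.
Qed.

End SmoothForms.

Lemma pairl_continuous (S T : topologicalType) (x : S) :
  continuous (fun y : T => (x, y)).
Proof.
by move=> y; apply: (@cvg_pair _ _ _ (nbhs y) (nbhs x) (nbhs y) _ _ _ (cst x) id);
  [exact: cvg_cst|exact: cvg_id].
Qed.

Lemma pairr_continuous (S T : topologicalType) (y : T) :
  continuous (fun x : S => (x, y)).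
Proof.
by move=> x; apply: (@cvg_pair _ _ _ (nbhs x) (nbhs x) (nbhs y) _ _ _ id (cst y));
  [exact: cvg_id|exact: cvg_cst].
Qed.

Section Bundle.
Context {R : realType} {d : nat} (M : manifold R d).
Implicit Types (i j : chart M) (x : M) (Q : set (TM M)).

Lemma tparam_chart_at x v :
  tparam (chart_at x) (phi (chart_at x) x, v) = tvec x v.
Proof.
rewrite /tparam /= frame_chart_at mulmx1 phiK//.
exact: dom_chart_at.
Qed.

Lemma cod_chart_at x : cod (chart_at x) (phi (chart_at x) x).
Proof. by exists x => //; exact: dom_chart_at. Qed.

Lemma openTM_fiber Q x : open Q -> open (fiber Q x).
Proof.
move=> oQ; pose y := phi (chart_at x) x.
have -> : fiber Q x = (fun v => (y, v)) @^-1` tpre (chart_at x) Q.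
  apply/seteqP; split => v; rewrite /fiber /tpre /= tparam_chart_at.
    by move=> Qv; split=> //; exact: cod_chart_at.
  by case.
apply: open_comp (oQ (chart_at x)) => v _.
exact: pairl_continuous.
Qed.

Lemma openTM_proj Q : open Q -> open [set x | exists v, Q (tvec x v)].
Proof.
move=> oQ; rewrite openE => x [v Qv]; pose i := chart_at x.
have dx : dom i x := dom_chart_at x.
have oP : open ((fun y => (y, v)) @^-1` tpre i Q).
  apply: open_comp (oQ i) => y _.
  exact: pairr_continuous.
have Py : ((fun y => (y, v)) @^-1` tpre i Q) (phi i x).
  by split; [exact: cod_chart_at|rewrite /i tparam_chart_at].
have h := phi_continuous dx (open_nbhs_nbhs (conj oP Py)).
have h' := open_nbhs_nbhs (conj (@dom_open _ _ M i) dx).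
rewrite nbhs_filterE fmapE in h.
apply: filterS (filterI h h') => z [/= [_ Qz] dz].
by exists (v *m frame i (phi i z)); move: Qz; rewrite /tparam /= phiK.
Qed.

Lemma tpreT_open i : open (fst @^-1` cod i : set ('rV[R]_d * 'rV[R]_d)).
Proof. by apply: open_comp; [move=> z _; exact: cvg_fst|exact: cod_open]. Qed.

Section Forms.
Variables (a : M -> 'M[R]_d) (b : M -> 'cV[R]_d).
Hypotheses (sa : smooth_bilinear a) (sb : smooth_form b).

Lemma Aform_tparam i yw : Aform a (tparam i yw) =
  bil (frame i yw.1 *m a (psi i yw.1) *m (frame i yw.1)^T) yw.2 yw.2.
Proof. by rewrite bil_congr. Qed.

Lemma Bform_tparam i yw : Bform b (tparam i yw) =
  lin (frame i yw.1 *m b (psi i yw.1)) yw.2.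
Proof. by rewrite /lin mulmxA. Qed.

Lemma Aform_smooth i : smooth_on (fst @^-1` cod i)
  (fun yw => Aform a (tparam i yw) : R^o).
Proof.
move=> N; have oU := @tpreT_open i.
apply: (Ck_eq oU (fun yw _ => esym (Aform_tparam i yw))).
apply: Ck_bil => //; [|exact: smooth_snd|exact: smooth_snd].
exact: (@Ck_fst R _ 'rV[R]_d _ N (cod i) _ (@cod_open _ _ M i) (sa i N)).
Qed.

Lemma Bform_smooth i : smooth_on (fst @^-1` cod i)
  (fun yw => Bform b (tparam i yw) : R^o).
Proof.
move=> N; have oU := @tpreT_open i.
apply: (Ck_eq oU (fun yw _ => esym (Bform_tparam i yw))).
apply: Ck_lin => //; last exact: smooth_snd.
exact: (@Ck_fst R _ 'rV[R]_d _ N (cod i) _ (@cod_open _ _ M i) (sb i N)).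
Qed.

Lemma cone_smooth i k m : smooth_on (fst @^-1` cod i)
  (fun yw => k * Aform a (tparam i yw) + m * Bform b (tparam i yw) ^+ 2 : R^o).
Proof.
move=> N; have oU := @tpreT_open i.
have cst (c : R^o) := Ck_cst N (fst @^-1` cod i : set ('rV[R]_d * 'rV[R]_d)) c.
have C1 := Ck_mul oU (cst k) (@Aform_smooth i N).
have C2 := Ck_mul oU (cst m) (Ck_mul oU (@Bform_smooth i N) (@Bform_smooth i N)).
exact: (Ck_add oU C1 C2).
Qed.

Lemma kundt_cone_open k m : open (kundt_cone a b k m).
Proof. by move=> i; exact: (open_gt0 (@tpreT_open i) (@cone_smooth i k m 0%N)). Qed.

Lemma Bform_gt0_open : open [set xv | 0 < Bform b xv].
Proof. by move=> i; exact: (open_gt0 (@tpreT_open i) (@Bform_smooth i 0%N)). Qed.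

Lemma kundt_smooth p k m Q : open Q -> Q `<=` kundt_dom a b k m ->
  smooth_TM Q (kundt a b p k m).
Proof.
move=> oQ QD i N.
have oU : open (tpre i Q) by exact: oQ.
have UT : tpre i Q `<=` fst @^-1` cod i by move=> yw [].
have dom yw : tpre i Q yw -> [/\ 0 < Aform a (tparam i yw),
    Bform b (tparam i yw) != 0 & 0 < k * Aform a (tparam i yw) +
      m * Bform b (tparam i yw) ^+ 2].
  by case=> _ /QD/kundt_domE.
apply: (Ck_eq oU (f := fun yw => (Bform b (tparam i yw) ^+ 2) `^ (- p) *
    (k * Aform a (tparam i yw) + m * Bform b (tparam i yw) ^+ 2) `^ (p + 1))).
  by move=> yw [_ /QD/kundtE <-].
apply: Ck_mul => //; apply: Ck_powR => //.
- by move=> yw /dom[_ B0 _]; rewrite exprn_even_gt0.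
- exact: (Ck_sub UT (Ck_mul (@tpreT_open i) (@Bform_smooth i N) (@Bform_smooth i N))).
- by move=> yw /dom[].
- exact: (Ck_sub UT (@cone_smooth i k m N)).
Qed.

End Forms.

End Bundle.

Section TangentBundleTopology.
Context {R : realType} {d : nat} (M : manifold R d).
Implicit Types (i j : chart M) (x : M) (Q : set (TM M)).

(* A relatively clopen part of Q is a union of fibers, and since the projection
   is open it has a clopen image in M. *)
Lemma connected_total Q : connected [set: M] -> open Q ->
  (forall x, fiber Q x !=set0) -> (forall x, connected (fiber Q x)) ->
  connected Q.
Proof.
move=> cM oQ Q0 cQ B B0 [U oU BU] [Z cZ BZ].
have fib x : fiber B x !=set0 -> fiber B x = fiber Q x.
  move=> B0x; apply: cQ => //.
    by exists (fiber U x); [exact: openTM_fiber|rewrite BU].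
  exists (fiber Z x); last by rewrite BZ.
  by rewrite -openC; apply: (@openTM_fiber _ _ _ (~` Z)); rewrite openC.
pose P := [set x | exists v, B (tvec x v)].
have PT : P = [set: M].
  apply: cM; first by case: B0 => -[x v] Bv; exists x, v.
    exists P; last by rewrite setTI.
    by apply: openTM_proj; rewrite BU; exact: openI.
  exists P; last by rewrite setTI.
  rewrite -openC.
  have -> : ~` P = [set x | exists v, (Q `&` ~` Z) (tvec x v)].
    apply/seteqP; split=> x.
      move=> nP; have [v Qv] := Q0 x; exists v; split=> // Zv.
      by apply: nP; exists v; rewrite BZ.
    move=> [v [Qv nZ]] [w Bw]; apply: nZ.
    have : fiber B x v by rewrite fib//; exists w.
    by rewrite /fiber /= BZ => -[].
  by apply: openTM_proj; apply: openI => //; rewrite openC.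
apply/seteqP; split=> [xv|[x v] Qv]; first by rewrite BU => -[].
have : P x by rewrite PT.
by move=> Px; rewrite -[B _]/(fiber B x v) fib.
Qed.

(* A neighbourhood in TM with constant fibre G in the coordinates of the chart i;
   it turns the continuity of a section of TM into that of its coordinates. *)
Definition chart_cone i (G : set 'rV[R]_d) : set (TM M) :=
  [set xv | dom i xv.1 /\ G (xv.2 *m invmx (frame i (phi i xv.1)))].

Lemma chart_cone_open i G : open G -> open (chart_cone i G).
Proof.
move=> oG; suff : openTM (chart_cone i G) by [].
move=> j; pose tr := phi i \o psi j.
pose U : set ('rV[R]_d * 'rV[R]_d) := fst @^-1` (cod j `&` psi j @^-1` dom i).
have oU : open U.
  by apply: open_comp; [move=> x _; exact: cvg_fst|exact: overlap_open].
(* The coordinates in the chart i of the tangent vector [tparam j yw]. The jacobian of the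
   transition map is expanded into directional derivatives, which are what [Ck] controls. *)
pose f (yw : 'rV[R]_d * 'rV[R]_d) := \sum_l yw.2 0 l *: 'D_(delta_mx 0 l) tr yw.1.
have fE yw : U yw -> f yw =
    (tparam j yw).2 *m invmx (frame i (phi i (tparam j yw).1)).
  case: yw => y w [/= cy dy]; rewrite (frame_chain cy dy) mulmxA mulmxK; last first.
    by apply: frame_unit; exists (psi j y).
  rewrite {2}(row_sum_delta w) mulmx_suml; apply: eq_bigr => l _.
  by rewrite -scalemxAl deriveEjacobian//; exact: transition_diff.
have -> : tpre j (chart_cone i G) = U `&` f @^-1` G.
  apply/seteqP; split=> yw.
    by case=> cy [dy Gy]; split=> //; rewrite /= fE.
  by case=> -[cy dy]; rewrite /= fE// => Gy; split.
have Cf : Ck 0 U f.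
  apply: Ck_sum => // l yw Uyw; apply: cvgZ.
    have C1 : Ck 0 U (fun yw => yw.2 0 l : R^o).
      by apply: (Ck_coord _ _ oU); exact: smooth_snd.
    exact: C1.
  have [_ Cd] := @transition_Ck _ _ M j i 1.
  have C2 := @Ck_fst R _ 'rV[R]_d _ 0 _ _ (@overlap_open _ _ M j i) (Cd (delta_mx 0 l)).
  exact: C2.
rewrite openE => yw [Uyw Gf]; apply: filterI.
  exact: (open_nbhs_nbhs (conj oU Uyw)).
exact: (Cf yw Uyw _ (open_nbhs_nbhs (conj oG Gf))).
Qed.

Section TimeOrientation.
Variables (a : M -> 'M[R]_d) (Ta : set (TM M)).
Hypotheses (sa : smooth_bilinear a) (la : forall x, lorentzian (a x)).
Hypothesis oTa : time_orientation a Ta.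

Lemma time_cone_component x (v0 : 'rV[R]_d) : fiber Ta x v0 ->
  0 < bil (a x) v0 v0 /\
  fiber Ta x = [set v | 0 < bil (a x) v v /\ 0 < bil (a x) v0 v].
Proof.
have [/(_ x) [w Aw TaE] _] := oTa.
rewrite {}TaE (_ : fiber _ x = [set v | 0 < bil (a x) v v])// => wv0.
have v00 := connected_component_sub wv0; split=> //.
by rewrite -(timelike_component (la x) v00); exact: same_connected_component.
Qed.

Lemma time_cone_nonempty x : exists v0, [/\ fiber Ta x v0, 0 < bil (a x) v0 v0 &
  fiber Ta x = [set v | 0 < bil (a x) v v /\ 0 < bil (a x) v0 v]].
Proof.
have [/(_ x) [w Aw TaE] _] := oTa; exists w.
have Tw : fiber Ta x w by rewrite TaE; exact: connected_component_refl.
by have [] := time_cone_component Tw.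
Qed.

(** Over the domain of the local field X, membership in [Ta] means A > 0 and a(X, w) > 0; both are
    open conditions. *)
Lemma time_orientation_open : open Ta.
Proof.
suff : openTM Ta by [].
move=> i; rewrite openE => -[y0 w0] [/= cy0 T0].
have [di0 phi0] := cod_psi cy0; set x0 := psi i y0 in di0 phi0 *.
have [_ /(_ x0) [U [X [oU Ux0 TX cX]]]] := oTa.
have uF0 := frame_unit cy0.
pose xi0 := X x0 *m invmx (frame i y0).
pose S y := frame i y *m a (psi i y) *m (frame i y)^T.
(* The coordinates of X form a separate variable of h: X is continuous only as a section of TM, and
   [chart_cone] later keeps these coordinates near xi0. *)
pose V := 'rV[R]_d; pose h (z : V * (V * V)) : R^o := bil (S z.2.1) z.1 z.2.2.
pose W : set (V * (V * V)) := snd @^-1` (fst @^-1` cod i).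
have oW : open W.
  by apply: open_comp; [move=> z _; exact: cvg_snd|exact: tpreT_open].
have C2 : Ck 0 (fst @^-1` cod i : set (V * V)) (fun yw => S yw.1).
  exact: (@Ck_fst R _ V _ 0 _ _ (@cod_open _ _ M i) (sa i 0%N)).
have Ch : Ck 0 W h.
  apply: (@Ck_bil R _ 0 _ W (fun z => S z.2.1) (fun z => z.1) (fun z => z.2.2) oW).
  - exact: (@Ck_snd R V _ _ 0 _ _ (@tpreT_open _ _ M i) C2).
  - exact: (@smooth_fst R _ _ 0 W).
  - have C3 := @smooth_snd R V V 0 (fst @^-1` cod i).
    exact: (@Ck_snd R V _ _ 0 _ _ (@tpreT_open _ _ M i) C3).
have hE y w v : bil (S y) (v *m invmx (frame i y)) w =
    bil (a (psi i y)) (v *m invmx (frame i y) *m frame i y) (w *m frame i y).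
  by rewrite bil_congr.
have h0 : 0 < h (xi0, (y0, w0)).
  rewrite /h /= hE mulmxKV//.
  have [_ e] := time_cone_component (TX _ Ux0).
  by move: T0; rewrite -[Ta _]/(fiber Ta x0 _) e => -[].
have : nbhs ((xi0, (y0, w0)) : V * (V * V)) [set z | 0 < h z].
  have /cvgr_gt := Ch (xi0, (y0, w0)) cy0.
  by move=> /(_ 0 h0).
case=> -[/= G N] [nG nN] GN.
have [G' [[oG' G'xi] G'G]] : exists G', open_nbhs xi0 G' /\ G' `<=` G.
  by move: nG; rewrite nbhsE => -[G' ? ?]; exists G'.
have oC : open (chart_cone i G') by exact: chart_cone_open.
have Cx : chart_cone i G' (tvec x0 (X x0)).
  split; first exact: di0.
  by rewrite phi0.
have nX := cX _ Ux0 _ (open_nbhs_nbhs (conj oC Cx)).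
rewrite nbhs_filterE fmapE in nX.
have nUX := @filterI _ _ (nbhs_filter x0) _ _ (open_nbhs_nbhs (conj oU Ux0)) nX.
have nU := psi_continuous cy0 nUX.
rewrite nbhs_filterE fmapE in nU.
have oA := @open_gt0 R _ _ _ (@tpreT_open _ _ M i) (@Aform_smooth _ _ _ _ sa i 0%N).
have nA : nbhs (y0, w0) ((fst @^-1` cod i) `&`
    [set yw | 0 < Aform a (tparam i yw)]).
  apply: open_nbhs_nbhs; split => //; split => //=.
  by have [] := time_cone_component T0.
move: nU; set Z := psi i @^-1` _ => nU.
have nU' : nbhs ((y0, w0) : V * V) (fst @^-1` Z).
  by exists (Z, setT); [split=> /=; [exact: nU|exact: filterT]|move=> z []].
have nF := @nbhs_filter (V * V)%type (y0, w0).
have nNA := @filterI _ _ nF _ _ (@filterI _ _ nF _ _ nN nA) nU'.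
apply: filterS nNA => -[y w] /= [[Nyw [cy Ayw]] [Uy [dy Gy]]].
have [e1 e2] := cod_psi cy; split; first exact: cy.
have [_ TE] := time_cone_component (TX _ Uy).
rewrite -[Ta _]/(fiber Ta (psi i y) (w *m frame i y)) TE.
split; first exact: Ayw.
move: Gy => /=; rewrite e2 => /G'G Gy.
have : 0 < bil (S y) (X (psi i y) *m invmx (frame i y)) w.
  exact: (GN (_, (y, w)) (conj Gy Nyw)).
rewrite hE mulmxKV; last exact: frame_unit.
exact: id.
Qed.

End TimeOrientation.

End TangentBundleTopology.

(** * Kundt spacetimes *)

Section KundtSpacetime.
Context {R : realType} {d : nat} (M : manifold R d).
Variables (a : M -> 'M[R]_d) (b : M -> 'cV[R]_d) (Ta : set (TM M)) (p k m : R).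
Variable Adom : set (TM M).
Hypotheses (d2 : (2 < d)%N) (cM : connected [set: M]).
Hypotheses (a_metric : lorentzian_metric a) (sb : smooth_form b).
Hypotheses (oTa : time_orientation a Ta) (k_neq0 : k != 0) (m_neq0 : m != 0).
Hypothesis Adom_max :
  maximal_pseudo_finsler (kundt a b p k m) (kundt_dom a b k m) Adom.

Let sa : smooth_bilinear a := a_metric.1.
Let la x : lorentzian (a x) := a_metric.2 x.
Local Notation L := (kundt a b p k m).
Local Notation C x := (cone_form (a x) (b x) k m).

Lemma Adom_fiber x : exists v, Adom (tvec x v).
Proof. by case: Adom_max => -[[_ _ + _] _ _ _ _] _ => /(_ x). Qed.

Lemma Adom_dom x v : Adom (tvec x v) ->
  [/\ 0 < bil (a x) v v, lin (b x) v != 0 & 0 < C x v].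
Proof. by case: Adom_max => -[_ + _ _ _] _ => /[apply] /kundt_domE. Qed.

Lemma form_neq0 x : b x != 0.
Proof.
have [v /Adom_dom[_ + _]] := Adom_fiber x.
by apply: contra => /eqP ->; rewrite /lin mulmx0 mxE.
Qed.

Lemma norm_neq0 x : p = 1 -> conorm (a x) (b x) != 0.
Proof.
move=> p1; apply/eqP => n0; have [v Av] := Adom_fiber x.
have [A0 B0 C0] := Adom_dom Av.
have := kundt_metric_degenerate (la x) A0 B0 C0 k_neq0 p1 n0.
rewrite -fundamental_kundt//; last exact/kundt_domE.
by case: Adom_max => -[_ _ _ _ /(_ _ Av) ->].
Qed.

Lemma cone_meets_future x v0 : 0 < bil (a x) v0 v0 ->
  exists2 v, lin (b x) v != 0 & future_cone (a x) (b x) k m v0 v.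
Proof.
move=> v00; have [v /Adom_dom[A0 B0 C0]] := Adom_fiber x.
(* C is even, so the sign of v can be chosen to put it on the side of v0. *)
have := timelike_bil_neq0 (la x) v00 A0; rewrite neq_lt => /orP[h|h].
  exists (- v); first by rewrite linN oppr_eq0.
  by split; [rewrite -scaleN1r cone_formZ sqrrN expr1n mul1r|rewrite bilNr oppr_gt0].
by exists v.
Qed.

Lemma kundtZ x v (l : R) : 0 < l -> L (tvec x (l *: v)) = l ^+ 2 * L (tvec x v).
Proof.
move=> l0; rewrite /kundt /alpha_beta /=.
have -> : Aform a (tvec x (l *: v)) = l ^+ 2 * Aform a (tvec x v).
  by rewrite -[LHS]/(bil (a x) (l *: v) (l *: v)) !bilE mulrA.
have -> : Bform b (tvec x (l *: v)) = l * Bform b (tvec x v).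
  by rewrite -[LHS]/(lin (b x) (l *: v)) !bilE.
rewrite exprMn -mulf_div divff ?mul1r ?mulrA//.
by rewrite expf_neq0// gt_eqF.
Qed.

Section Necessity.
Variable T : set (TM M).
Hypothesis Tcones : finsler_spacetime_cones L Adom T.

Lemma cones_fiber_facts x :
  [/\ open (fiber T x), fiber T x !=set0,
      forall v, fiber T x v -> [/\ 0 < bil (a x) v v, lin (b x) v != 0 & 0 < C x v],
      {within closure (fiber T x), continuous (fun v =>
        if v \in fiber T x then kundt_form (a x) (b x) p k m v else 0 : R)} &
      forall v, fiber T x v -> lorentzian (kundt_metric (a x) (b x) p k m v)].
Proof.
case: Tcones => -[[[_ oT] _ T0 _] TA] _ _ Tl Text.
have TD v : fiber T x v -> [/\ 0 < bil (a x) v v, lin (b x) v != 0 & 0 < C x v].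
  by move=> /TA/Adom_dom.
split => //; first exact: openTM_fiber.
  have -> : (fun v => if v \in fiber T x then kundt_form (a x) (b x) p k m v else 0 : R) =
            (fun v => if v \in fiber T x then L (tvec x v) else 0).
    apply/funext => v; case: ifPn => // /set_mem /TD/kundt_domE dv.
    by rewrite kundt_kundt_form.
  exact: Text.
move=> v Tv; rewrite -fundamental_kundt//; first exact: Tl.
exact/kundt_domE/TD.
Qed.

Lemma cones_necessary : M -> [/\ 0 < k, m < 0, -1 < p <= 1 &
  forall x, form_norm a b x < 0 -> p < 0].
Proof.
move=> x; have [oK K0 KD Kext Kl] := cones_fiber_facts x.
have [m0 k0] := kundt_signs (la x) d2 m_neq0 oK K0 KD Kext.
split=> // [|y n0].
  apply/andP; split.
    exact: (exponent_gtN1 (la x) d2 m_neq0 oK K0 KD Kext).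
  exact: (exponent_le1 (la x) d2 m_neq0 oK K0 KD Kext Kl).
have [oK' K0' KD' Kext' _] := cones_fiber_facts y.
exact: (exponent_lt0 (la y) d2 m_neq0 oK' K0' KD' Kext' n0).
Qed.

End Necessity.

Section Sufficiency.
Variable T : set (TM M).
Hypotheses (k0 : 0 < k) (p1 : -1 < p).
Hypotheses (oT : open T) (T0 : forall x, fiber T x !=set0).
Hypotheses (cT : forall x, connected (fiber T x)).
Hypothesis TZ : forall x v (l : R), 0 < l -> T (tvec x v) -> T (tvec x (l *: v)).
Hypothesis TD : forall x v, T (tvec x v) ->
  [/\ 0 < bil (a x) v v, lin (b x) v != 0 & 0 < C x v].
Hypothesis Tdisc : forall x v, T (tvec x v) ->
  0 < kundt_discriminant (a x) (b x) p k m v.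
Hypothesis Tsmall : forall x w (e : R), closure (fiber T x) w -> ~ fiber T x w ->
  0 < e -> \forall v \near w, fiber T x v -> kundt_form (a x) (b x) p k m v < e.

Lemma cones_sufficient : M -> finsler_spacetime_cones L Adom T.
Proof.
move=> x0.
have Tdom : T `<=` kundt_dom a b k m by move=> [x v] /TD ?; exact/kundt_domE.
have Tl xv : T xv -> lorentzian (fundamental L xv).
  case: xv => x v Tv; have [A0 B0 C0] := TD Tv.
  rewrite -[(x, v)]/(tvec x v) fundamental_kundt; [|exact: la|exact: Tdom].
  by apply: kundt_metric_lorentzian => //; exact: Tdisc.
have Tconic : conic_subbundle T.
  split=> //.
  - by split=> //; have [v Tv] := T0 x0; exists (tvec x0 v).
  - by move=> x v /TD[A0 _ _]; apply: contraTneq A0 => ->; rewrite bil0l ltxx.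
have TA : T `<=` Adom.
  apply: Adom_max.2; split => //; first exact: kundt_smooth.
    by move=> x v l l0 _; exact: kundtZ.
  by move=> xv /Tl; exact: lorentzian_unit.
split=> //.
- by split=> //; exact: connected_total.
- move=> [x v] Tv; rewrite -[(x, v)]/(tvec x v) kundt_kundt_form; last exact: Tdom.
  by have [A0 B0 C0] := TD Tv; exact: kundt_form_gt0.
- move=> x.
  have -> : (fun v => if v \in fiber T x then L (tvec x v) else 0) =
     (fun v => if v \in fiber T x then kundt_form (a x) (b x) p k m v else 0 : R).
    apply/funext => v; case: ifPn => // /set_mem Tv.
    by rewrite kundt_kundt_form//; exact: Tdom.
  apply: kundt_extension => [|v /TD[]//|]; first exact: openTM_fiber.
  exact: Tsmall.
Qed.

End Sufficiency.

Section Cones.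
Hypotheses (k0 : 0 < k) (m0 : m < 0).

Definition future_kundt_cone : set (TM M) := kundt_cone a b k m `&` Ta.

Definition future_kundt_half_cone : set (TM M) :=
  future_kundt_cone `&` [set xv | 0 < Bform b xv].

Lemma fiber_future_kundt_cone x v0 :
  fiber Ta x = [set v | 0 < bil (a x) v v /\ 0 < bil (a x) v0 v] ->
  fiber future_kundt_cone x = future_cone (a x) (b x) k m v0.
Proof.
move=> TE; apply/seteqP; split=> v.
  case=> Cv; rewrite -[Ta _]/(fiber Ta x v) TE => -[_ h].
  by split.
move=> [Cv h]; split=> //.
rewrite -[Ta _]/(fiber Ta x v) TE; split => //.
exact: (cone_form_timelike k0 m0 Cv).
Qed.

Lemma fiber_future_kundt_half_cone x v0 :
  fiber Ta x = [set v | 0 < bil (a x) v v /\ 0 < bil (a x) v0 v] ->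
  fiber future_kundt_half_cone x =
  future_cone (a x) (b x) k m v0 `&` [set v | 0 < lin (b x) v].
Proof. by move=> /fiber_future_kundt_cone <-. Qed.

Lemma future_kundt_coneZ x v (l : R) : 0 < l ->
  future_kundt_cone (tvec x v) -> future_kundt_cone (tvec x (l *: v)).
Proof.
move=> l0; have [v0 [_ v00 TE]] := time_cone_nonempty la oTa x.
have FE := fiber_future_kundt_cone TE.
rewrite -![future_kundt_cone _]/(fiber future_kundt_cone x _) FE.
exact: future_coneZ.
Qed.

Lemma future_kundt_cone_open : open future_kundt_cone.
Proof.
apply: openI; last exact: (time_orientation_open sa la oTa).
exact: kundt_cone_open.
Qed.

(** If C were positive at w, then w would be timelike; a(v0, w) is nonnegative in the closure and
    nonzero between timelike vectors, so w would lie in the cone. *)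
Lemma closure_future_cone x v0 w : 0 < bil (a x) v0 v0 ->
  closure (future_cone (a x) (b x) k m v0) w ->
  ~ future_cone (a x) (b x) k m v0 w -> C x w <= 0.
Proof.
move=> v00 cw nw; rewrite leNgt; apply/negP => Cw; apply: nw; split=> //.
have Aw := cone_form_timelike k0 m0 Cw.
rewrite lt_def (timelike_bil_neq0 (la x))//=.
have cl : closed [set v | 0 <= bil (a x) v0 v].
  apply: (@closed_comp _ _ (fun w => bil (a x) v0 w : R^o) [set y | 0 <= y]).
    by move=> v _; exact: (bil_continuous (la x)).
  exact: closed_ge.
suff : closure [set v | 0 <= bil (a x) v0 v] w.
  by rewrite -(closure_id _).1.
by apply: closure_subset cw => v [_ /ltW].
Qed.

Lemma future_kundt_cone_cones : (forall x, 0 <= form_norm a b x) ->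
  -1 < p <= 1 -> M -> finsler_spacetime_cones L Adom future_kundt_cone.
Proof.
move=> n0 /andP[p1 p2] x0.
have fut x : exists2 v0, 0 < bil (a x) v0 v0 &
    fiber future_kundt_cone x = future_cone (a x) (b x) k m v0.
  have [v0 [_ v00 TE]] := time_cone_nonempty la oTa x.
  by exists v0 => //; exact: fiber_future_kundt_cone.
have TD x v : future_kundt_cone (tvec x v) ->
    [/\ 0 < bil (a x) v v, lin (b x) v != 0 & 0 < C x v].
  have [v0 v00 FE] := fut x.
  rewrite -[future_kundt_cone _]/(fiber future_kundt_cone x v) FE => -[Cv _].
  have Av := cone_form_timelike k0 m0 Cv; split=> //.
  exact: (lin_neq0 (la x) (form_neq0 x) (n0 x) Av).
apply: cones_sufficient => //.
- exact: future_kundt_cone_open.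
- move=> x; have [v0 v00 ->] := fut x.
  by have [v _ vF] := cone_meets_future v00; exists v.
- move=> x; have [v0 v00 ->] := fut x.
  exact: (future_cone_connected (c := b x) (la x) k0 m0 v00).
- exact: future_kundt_coneZ.
- move=> x v /TD[Av Bv Cv].
  apply: (kundt_discriminant_gt0_pos (la x)) => //; first exact: n0.
  exact: norm_neq0.
move=> x w e cw nw e0.
have Cw : C x w <= 0.
  by have [v0 v00 FE] := fut x; rewrite FE in cw nw; exact: closure_future_cone cw nw.
have small : \forall v \near w, 0 < C x v -> kundt_form (a x) (b x) p k m v < e.
  have [p0|p0] := ltrP p 0; first by apply: kundt_small_neg => //; right.
  have [Bw|Bw] := eqVneq (lin (b x) w) 0; last exact: kundt_small_region.
  apply: (kundt_small_causal (la x) k0 m0 (form_neq0 x) (n0 x)) => //.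
    by rewrite p0.
  exact: norm_neq0.
by apply: filterS small => v h /TD[_ _]; exact: h.
Qed.

Lemma future_kundt_half_cone_cones : (forall x, form_norm a b x < 0) ->
  -1 < p < 0 -> M -> finsler_spacetime_cones L Adom future_kundt_half_cone.
Proof.
move=> n0 /andP[p1 p0] x0.
have fut x : exists2 v0, 0 < bil (a x) v0 v0 & fiber future_kundt_half_cone x =
    future_cone (a x) (b x) k m v0 `&` [set v | 0 < lin (b x) v].
  have [v0 [_ v00 TE]] := time_cone_nonempty la oTa x.
  by exists v0 => //; exact: fiber_future_kundt_half_cone.
have TD x v : future_kundt_half_cone (tvec x v) ->
    [/\ 0 < bil (a x) v v, lin (b x) v != 0 & 0 < C x v].
  have [v0 v00 FE] := fut x.
  rewrite -[future_kundt_half_cone _]/(fiber future_kundt_half_cone x v) FE.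
  move=> -[[Cv _] /lt0r_neq0 Bv].
  by have Av := cone_form_timelike k0 m0 Cv.
apply: cones_sufficient => //.
- apply: openI; first exact: future_kundt_cone_open.
  exact: Bform_gt0_open.
- move=> x; have [v0 v00 ->] := fut x.
  have [v B0 [Cv vF]] := cone_meets_future v00.
  have [Bv|Bv] := ltrP 0 (lin (b x) v); first by exists v.
  have {B0 Bv} Bv : lin (b x) v < 0 by rewrite lt_neqAle B0.
  (* The reflection of v in ker b: it preserves A, hence C, and reverses B. Since n < 0, a(v, v') =
     A - 2 B^2 / n is positive, so v' stays in the same time cone. *)
  pose v' := v - (2 * lin (b x) v / conorm (a x) (b x)) *: sharp (a x) (b x).
  have n0' : conorm (a x) (b x) != 0 by rewrite lt_eqF// n0.
  have aT := lorentzian_sym (la x).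
  have Bv' : lin (b x) v' = - lin (b x) v.
    by rewrite /v' !bilE (lin_sharp _ (la x)); field.
  have Av' : bil (a x) v' v' = bil (a x) v v.
    rewrite /v' !bilE (bilC (sharp _ _) v aT) !(bil_sharp _ (la x)).
    by rewrite (lin_sharp _ (la x)); field.
  have Cv' : 0 < C x v' by rewrite /cone_form Av' Bv' sqrrN.
  have Av := cone_form_timelike k0 m0 Cv.
  exists v'; split; last by rewrite /= Bv' oppr_gt0.
  split=> //; apply: (@same_cone _ _ _ (la x) v) => //.
  - by rewrite Av'.
  - by rewrite (bilC v v0 aT).
  rewrite /v' !bilE (bil_sharp _ (la x)).
  rewrite (_ : _ - _ = bil (a x) v v + 2 * lin (b x) v ^+ 2 / - conorm (a x) (b x)).
    have B2 : 0 < lin (b x) v ^+ 2 by rewrite exprn_even_gt0//= lt_eqF.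
    by rewrite addr_gt0// divr_gt0 ?oppr_gt0//; [rewrite mulr_gt0|exact: n0].
  by field.
- move=> x; have [v0 v00 ->] := fut x.
  exact: (future_half_cone_connected (la x) k0 m0 v00).
- move=> x v l l0 [Fv Bv]; split; first exact: future_kundt_coneZ.
  by rewrite /= -[Bform _ _]/(lin (b x) (l *: v)) linZ mulr_gt0.
- move=> x v /TD[Av Bv Cv].
  by apply: kundt_discriminant_gt0_neg => //; exact: n0.
move=> x w e cw nw e0.
have BC : lin (b x) w = 0 \/ C x w <= 0.
  have [v0 v00 FE] := fut x; rewrite FE in cw nw.
  have [fw|nfw] := pselect (future_cone (a x) (b x) k m v0 w); last first.
    by right; apply: closure_future_cone nfw => //; apply: closure_subset cw => v [].
  left; apply/eqP; rewrite eq_le; apply/andP; split.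
    by rewrite leNgt; apply/negP => Bw; apply: nw.
  have cl : closed [set v | 0 <= lin (b x) v].
    apply: (@closed_comp _ _ (lin (b x) : _ -> R^o) [set y | 0 <= y]).
      by move=> v _; exact: lin_continuous.
    exact: closed_ge.
  suff : closure [set v | 0 <= lin (b x) v] w by rewrite -(closure_id _).1.
  by apply: closure_subset cw => v [_ /ltW].
have small := kundt_small_neg p1 p0 BC e0.
by apply: filterS small => v h /TD[_ _]; exact: h.
Qed.

(** Each time cone of [a] contains exactly one component of {C > 0}, so the components named in (i)
    reduce to one at each x. *)
Lemma kundt_cone_component x (K : set 'rV[R]_d) :
  (is_component (fiber (kundt_cone a b k m) x) K /\ K `<=` fiber Ta x) <->
  K = fiber future_kundt_cone x.
Proof.
have [v0 [_ v00 TE]] := time_cone_nonempty la oTa x.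
have FE := fiber_future_kundt_cone TE.
have [v _ vF] := cone_meets_future v00.
have comp w : future_cone (a x) (b x) k m v0 w ->
    connected_component (fiber (kundt_cone a b k m) x) w =
    future_cone (a x) (b x) k m v0.
  exact: (future_cone_component (la x) k0 m0 v00).
split=> [[[w Sw KE] KT]|->].
  rewrite FE KE comp//; split=> //.
  have /KT : K w by rewrite KE; exact: connected_component_refl.
  by rewrite TE => -[].
by split; [exists v; [exact: vF.1|rewrite FE comp]|move=> w []].
Qed.

(** The vector common to T_x and the time cone decides between the two opposite halves of {C >
    0}. *)
Lemma cones_eq_future_cone T x : (forall x, 0 <= form_norm a b x) ->
  finsler_spacetime_cones L Adom T -> compatible_cones Ta T ->
  fiber T x = fiber future_kundt_cone x.
Proof.
move=> n0 Tc /(_ x) [v [Tv Tav]].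
have [v0 [_ v00 TE]] := time_cone_nonempty la oTa x.
rewrite (fiber_future_kundt_cone TE).
have [oK K0 KD Kext Kl] := cones_fiber_facts Tc x.
apply: (eq_future_cone (la x) k0 m0 oK _ v00 KD _ _ (form_neq0 x) (n0 x)).
- by case: Tc => _ [_ + _]; exact.
- exact: (closure_region_sub Kext).
- by exists v => //; move: Tav; rewrite TE => -[].
Qed.

Lemma cones_eq_future_half_cone T x :
  finsler_spacetime_cones L Adom T -> compatible_cones Ta T ->
  (forall xv, T xv -> 0 < Bform b xv) ->
  fiber T x = fiber future_kundt_half_cone x.
Proof.
move=> Tc /(_ x) [v [Tv Tav]] TB.
have [v0 [_ v00 TE]] := time_cone_nonempty la oTa x.
rewrite (fiber_future_kundt_half_cone TE).
have [oK K0 KD Kext Kl] := cones_fiber_facts Tc x.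
apply: (eq_future_half_cone (la x) k0 m0 oK _ v00 KD).
- by case: Tc => _ [_ + _]; exact.
- exact: (closure_region_sub Kext).
- by exists v => //; move: Tav; rewrite TE => -[].
by move=> w Tw; exact: (TB (tvec x w)).
Qed.

End Cones.

End KundtSpacetime.

Lemma fiber_inj {R : realType} {d : nat} (M : manifold R d) (P Q : set (TM M)) :
  (forall x, fiber P x = fiber Q x) -> P = Q.
Proof.
move=> PQ; apply/seteqP; split => -[x v] h.
  by rewrite -[Q _]/(fiber Q x v) -PQ.
by rewrite -[P _]/(fiber P x v) PQ.
Qed.

Theorem proposition9 (R : realType) (M : manifold R 4)
  (M_connected : connected [set: points M]) (M_orientable : orientable M)
  (a : points M -> 'M[R]_4) (a_metric : lorentzian_metric a)
  (Ta : set (TM M)) (Ta_orientation : time_orientation a Ta)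
  (b : points M -> 'cV[R]_4) (b_smooth : smooth_form b)
  (b_type : (forall x, 0 <= form_norm a b x) \/
            (forall x, form_norm a b x < 0))
  (p k m : R) (k_neq0 : k != 0) (m_neq0 : m != 0)
  (Adom : set (TM M))
  (Adom_max : maximal_pseudo_finsler (kundt a b p k m) (kundt_dom a b k m) Adom) :
  let is_cones := fun T : set (TM M) =>
    finsler_spacetime_cones (kundt a b p k m) Adom T /\
    compatible_cones Ta T in
  let case_i := (forall x, 0 <= form_norm a b x) /\ (-1 < p <= 1) in
  let case_ii := (forall x, form_norm a b x < 0) /\ (-1 < p < 0) in
  [/\ (exists T, is_cones T) <->
        [/\ 0 < k, m < 0 & case_i \/ case_ii],
      0 < k -> m < 0 -> case_i -> forall T,
        is_cones T <->
        (forall x (K : set 'rV[R]_4),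
          is_component (fiber (kundt_cone a b k m) x) K /\
            K `<=` fiber Ta x <->
          K = fiber T x) &
      0 < k -> m < 0 -> case_ii -> forall T,
        is_cones T /\ (forall xv, T xv -> 0 < Bform b xv) <->
        (forall x, fiber T x =
          fiber (kundt_cone a b k m) x `&` fiber Ta x `&`
          fiber [set xv | 0 < Bform b xv] x)].
Proof.
move=> is_cones case_i case_ii.
(* A base point at which the pointwise conditions on k, m and p are evaluated. *)
have [[M0 v0] _] : Adom !=set0 by case: Adom_max => -[[[]]].
have sub_compat T : finsler_spacetime_cones (kundt a b p k m) Adom T ->
    T `<=` Ta -> is_cones T.
  move=> Tc TTa; split=> // x; case: (Tc) => -[[_ _ T0 _] _] _ _ _ _.
  by have [v Tv] := T0 x; exists v; split=> //; exact: TTa.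
have suff_i : 0 < k -> m < 0 -> case_i -> is_cones (future_kundt_cone a b Ta k m).
  move=> k0 m0 [n0 p1]; apply: sub_compat => [|xv []//].
  by apply: future_kundt_cone_cones.
have suff_ii : 0 < k -> m < 0 -> case_ii ->
    is_cones (future_kundt_half_cone a b Ta k m).
  move=> k0 m0 [n0 p1]; apply: sub_compat => [|xv [[]]//].
  by apply: future_kundt_half_cone_cones.
split.
- split=> [[T [Tc _]]|[k0 m0 [ci|cii]]]; last 2 first.
  + by exists (future_kundt_cone a b Ta k m); exact: suff_i.
  + by exists (future_kundt_half_cone a b Ta k m); exact: suff_ii.
  have [//|k0 m0 p1 pn] := cones_necessary _ a_metric m_neq0 Adom_max Tc M0.
  split=> //; case: b_type => n0; first by left.
  right; split=> //; case/andP: p1 => -> _ /=.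
  exact: pn (n0 M0).
- move=> k0 m0 ci T; have [n0 p1] := ci.
  have comp := kundt_cone_component a_metric Ta_orientation Adom_max k0 m0.
  split=> [[Tc Tcompat] x K|TK].
    have e := cones_eq_future_cone a_metric Ta_orientation Adom_max k0 m0 x n0 Tc Tcompat.
    by rewrite comp e.
  have -> : T = future_kundt_cone a b Ta k m; last exact: suff_i.
  apply: fiber_inj => x.
  (* Taking K = T_x, the hypothesis makes T_x itself a component inside the time cone, and there is
     only one. *)
  by have /comp := (TK x (fiber T x)).2 erefl.
- move=> k0 m0 cii T; have [n0 p1] := cii.
  split=> [[[Tc Tcompat] TB] x|TE].
    exact: (cones_eq_future_half_cone a_metric Ta_orientation Adom_max k0 m0 x Tc Tcompat TB).
  have -> : T = future_kundt_half_cone a b Ta k m by apply: fiber_inj.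
  by split; [exact: suff_ii|move=> xv []].
Qed.
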